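(* Let $F$ be a field of characteristic not two with separable closure $F^{\mathrm{sep}}$ and absolute Galois group $\Gamma$. Let $\mathbb{G}$ be an affine group superscheme over $F$, $V$ an irreducible representation of $\mathbb{G}$, and $V'$ an irreducible subrepresentation of $V\otimes_F F^{\mathrm{sep}}$. Then $V\cong\Pi V$ if and only if $\Pi V'\cong{}^\sigma V'$ for some $\sigma\in\Gamma$.
   Context: Affine group superschemes over $F$ correspond to commutative Hopf superalgebras; a representation is a right supercomodule, homomorphisms preserve parity, $\Pi V$ is the parity change of $V$ (same coaction). ${}^\sigma V'$ is the base change of $V'$ along $\sigma$, viewed as a representation of $\mathbb{G}\otimes_F F^{\mathrm{sep}}$. *)

(* Defs.v *)
From HB Require Import structures.
From mathcomp Require Import all_boot all_algebra all_field.
From mathcomp Require Import boolp.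

Set Implicit Arguments.
Unset Strict Implicit.
Unset Printing Implicit Defensive.

Import GRing.Theory.
Local Open Scope ring_scope.
Local Open Scope quotient_scope.

Notation bilinear_map b := (bilinear_for *:%R *:%R b).

(* Formal sums of pairs (v, w) stand for sums of elementary tensors. Two of
   them are identified when every bilinear map takes the same value on both,
   which by the universal property is equality in the tensor product. *)
Section Tensor.
Variables (F : fieldType) (V W : lmodType F).

Definition fsum (U : zmodType) (b : V -> W -> U) (s : seq (V * W)) : U :=
  \sum_(p <- s) b p.1 p.2.

Definition fsum_eq (s t : seq (V * W)) : Prop :=
  forall (U : lmodType F) (b : V -> W -> U), bilinear_map b ->
    fsum b s = fsum b t.

Definition fsum_eqb : rel (seq (V * W)) := fun s t => `[< fsum_eq s t >].

Lemma fsum_eqb_refl : reflexive fsum_eqb.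
Proof. by move=> s; apply/asboolP. Qed.

Lemma fsum_eqb_sym : symmetric fsum_eqb.
Proof.
move=> s t; apply/asboolP/asboolP => h U b hb; symmetry; exact: h.
Qed.

Lemma fsum_eqb_trans : transitive fsum_eqb.
Proof.
move=> t s u /asboolP h1 /asboolP h2; apply/asboolP => U b hb.
by rewrite (h1 U b hb); exact: h2.
Qed.

Canonical fsum_equiv :=
  EquivRel fsum_eqb fsum_eqb_refl fsum_eqb_sym fsum_eqb_trans.

Definition tensor := {eq_quot fsum_equiv}.
HB.instance Definition _ := EqQuotient.on tensor.
HB.instance Definition _ := Choice.on tensor.

Definition tens (v : V) (w : W) : tensor := \pi_tensor [:: (v, w)].

(* The map out of the tensor product induced by [b]; meaningful for
   bilinear [b]. *)
Definition tlift (U : zmodType) (b : V -> W -> U) (t : tensor) : U :=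
  fsum b (repr t).

Lemma tlift_pi (U : lmodType F) (b : V -> W -> U) s :
  bilinear_map b -> tlift b (\pi_tensor s) = fsum b s.
Proof.
move=> hb; rewrite /tlift.
have /eqmodP/asboolP h : repr (\pi_tensor s) = s %[mod tensor] by rewrite reprK.
exact: h.
Qed.

Lemma tens_ext (t u : tensor) :
  (forall (U : lmodType F) (b : V -> W -> U), bilinear_map b ->
     tlift b t = tlift b u) -> t = u.
Proof.
move=> h; rewrite -[t]reprK -[u]reprK; apply/eqmodP/asboolP => U b hb.
exact: h.
Qed.

Definition tens0 : tensor := \pi_tensor [::].
Definition tens_add (t u : tensor) : tensor :=
  \pi_tensor (repr t ++ repr u).
Definition tens_scale (a : F) (t : tensor) : tensor :=
  \pi_tensor [seq (a *: p.1, p.2) | p <- repr t].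
Definition tens_opp : tensor -> tensor := tens_scale (-1).

Section LiftOps.
Variables (U : lmodType F) (b : V -> W -> U) (hb : bilinear_map b).

Lemma tlift_0 : tlift b tens0 = 0.
Proof. by rewrite tlift_pi // /fsum big_nil. Qed.

Lemma tlift_add t u : tlift b (tens_add t u) = tlift b t + tlift b u.
Proof. by rewrite tlift_pi // /fsum big_cat. Qed.

Lemma bilinear_Zl a v w : b (a *: v) w = a *: b v w.
Proof. exact: (scalable_linear (hb.1 w)). Qed.

Lemma tlift_scale a t : tlift b (tens_scale a t) = a *: tlift b t.
Proof.
rewrite tlift_pi // /fsum big_map scaler_sumr; apply: eq_bigr => p _ /=.
exact: bilinear_Zl.
Qed.

End LiftOps.

Lemma tens_addA : associative tens_add.
Proof.
by move=> t u v; apply: tens_ext => U b hb; rewrite !tlift_add ?addrA.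
Qed.

Lemma tens_addC : commutative tens_add.
Proof. by move=> t u; apply: tens_ext => U b hb; rewrite !tlift_add // addrC. Qed.

Lemma tens_add0 : left_id tens0 tens_add.
Proof.
by move=> t; apply: tens_ext => U b hb; rewrite tlift_add // tlift_0 // add0r.
Qed.

Lemma tens_addN : left_inverse tens0 tens_opp tens_add.
Proof.
move=> t; apply: tens_ext => U b hb.
by rewrite tlift_add // tlift_0 // tlift_scale // scaleN1r addNr.
Qed.

HB.instance Definition _ :=
  GRing.isZmodule.Build tensor tens_addA tens_addC tens_add0 tens_addN.

Lemma tens_scaleA a c (t : tensor) :
  tens_scale a (tens_scale c t) = tens_scale (a * c) t.
Proof. by apply: tens_ext => U b hb; rewrite !tlift_scale // scalerA. Qed.

Lemma tens_scale1 : left_id 1 tens_scale.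
Proof. by move=> t; apply: tens_ext => U b hb; rewrite tlift_scale // scale1r. Qed.

Lemma tens_scaleDr : right_distributive tens_scale +%R.
Proof.
move=> a t u; apply: tens_ext => U b hb.
by rewrite tlift_scale // !tlift_add // !tlift_scale // scalerDr.
Qed.

Lemma tens_scaleDl (t : tensor) : {morph tens_scale^~ t : a c / a + c}.
Proof.
move=> a c; apply: tens_ext => U b hb.
by rewrite tlift_add // !tlift_scale // scalerDl.
Qed.

HB.instance Definition _ := GRing.Zmodule_isLmodule.Build F tensor
  tens_scaleA tens_scale1 tens_scaleDr tens_scaleDl.

Lemma tlift_linear (U : lmodType F) (b : V -> W -> U) :
  bilinear_map b -> linear (tlift b).
Proof. by move=> hb a t u; rewrite tlift_add // tlift_scale. Qed.

Lemma tliftE (U : lmodType F) (b : V -> W -> U) v w :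
  bilinear_map b -> tlift b (tens v w) = b v w.
Proof. by move=> hb; rewrite tlift_pi // /fsum big_seq1. Qed.

Lemma tens_bilinear : bilinear_map tens.
Proof.
split=> [w|v] a x y; apply: tens_ext => U b hb;
  rewrite tlift_linear // !tliftE //.
- exact: (hb.1 w).
- exact: (hb.2 v).
Qed.

Lemma tens_sum (t : tensor) : t = \sum_(p <- repr t) tens p.1 p.2.
Proof.
apply: tens_ext => U b hb; rewrite {1}/tlift /fsum.
elim: (repr t) => [|p s ih]; first by rewrite !big_nil tlift_0.
by rewrite !big_cons tlift_add // tliftE // ih.
Qed.

Lemma tensor_ext (U : zmodType) (f g : tensor -> U) :
  {morph f : x y / x + y} -> {morph g : x y / x + y} ->
  (forall v w, f (tens v w) = g (tens v w)) -> f =1 g.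
Proof.
move=> fD gD h t; rewrite [t]tens_sum.
have z0 (k : tensor -> U) : {morph k : x y / x + y} -> k 0 = 0.
  by move=> kD; apply: (addrI (k 0)); rewrite -kD !addr0.
elim: (repr t) => [|p s ih]; first by rewrite !big_nil !z0.
by rewrite !big_cons fD gD h ih.
Qed.

End Tensor.

Notation "V ⊗ W" := (tensor V W) (at level 40, left associativity) : type_scope.
Notation "v ⊗ₜ w" := (tens v w) (at level 40, left associativity) : ring_scope.

Section Linear.
Variables (F : fieldType) (U V : lmodType F) (f : U -> V) (hf : linear f).

Lemma lin_add : {morph f : x y / x + y}.
Proof. by move=> x y; rewrite -[x in LHS]scale1r hf scale1r. Qed.

Lemma lin_scale a x : f (a *: x) = a *: f x.
Proof. exact: (scalable_linear hf). Qed.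

Lemma lin_zero : f 0 = 0.
Proof. by rewrite -(scale0r 0) lin_scale scale0r. Qed.

End Linear.

Section TensorMaps.
Variable F : fieldType.

Definition tmap (V W V' W' : lmodType F) (f : V -> V') (g : W -> W') :
  V ⊗ W -> V' ⊗ W' := tlift (fun v w => f v ⊗ₜ g w).

Definition tassoc (V W X : lmodType F) : (V ⊗ W) ⊗ X -> V ⊗ (W ⊗ X) :=
  tlift (fun t x => tlift (fun v w => v ⊗ₜ (w ⊗ₜ x)) t).

Lemma linear_id (V : lmodType F) : linear (id : V -> V).
Proof. by []. Qed.

Lemma linear_comp (U V W : lmodType F) (f : V -> W) (g : U -> V) :
  linear f -> linear g -> linear (f \o g).
Proof. by move=> hf hg a u v /=; rewrite hg hf. Qed.

Lemma linear_add (U V : lmodType F) (f g : U -> V) :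
  linear f -> linear g -> linear (fun x => f x + g x).
Proof. by move=> hf hg a u v /=; rewrite hg hf scalerDr addrACA. Qed.

Lemma bilinear_comp (V W V' W' U : lmodType F) (b : V' -> W' -> U)
    (f : V -> V') (g : W -> W') :
  bilinear_map b -> linear f -> linear g ->
  bilinear_map (fun v w => b (f v) (g w)).
Proof.
move=> hb hf hg; split=> [w|v] a x y /=; first by rewrite hf (hb.1 (g w)).
by rewrite hg (hb.2 (f v)).
Qed.

Section TMap.
Variables (V W V' W' : lmodType F) (f : V -> V') (g : W -> W').
Hypotheses (hf : linear f) (hg : linear g).

Lemma tmap_bilinear : bilinear_map (fun v w => f v ⊗ₜ g w).
Proof. exact: (bilinear_comp (tens_bilinear _ _)). Qed.

Lemma tmap_linear : linear (tmap f g).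
Proof. exact: tlift_linear tmap_bilinear. Qed.

Lemma tmapE v w : tmap f g (v ⊗ₜ w) = f v ⊗ₜ g w.
Proof. exact: (tliftE _ _ tmap_bilinear). Qed.

End TMap.

Lemma linear_ext (V W U : lmodType F) (f g : V ⊗ W -> U) :
  linear f -> linear g -> (forall v w, f (v ⊗ₜ w) = g (v ⊗ₜ w)) -> f =1 g.
Proof. by move=> hf hg; apply: tensor_ext; exact: lin_add. Qed.

Section TAssoc.
Variables V W X : lmodType F.

Lemma tassoc_bilinear1 (x : X) :
  bilinear_map (fun (v : V) (w : W) => v ⊗ₜ (w ⊗ₜ x)).
Proof.
apply: (bilinear_comp (tens_bilinear _ _)) => // a u v.
exact: ((tens_bilinear _ _).1 x).
Qed.

Lemma tassoc_bilinear : bilinear_map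
  (fun (t : V ⊗ W) (x : X) => tlift (fun v w => v ⊗ₜ (w ⊗ₜ x)) t).
Proof.
split=> [x|t]; first exact: (tlift_linear (tassoc_bilinear1 x)).
move=> a x y; move: t; apply: linear_ext.
- exact: tlift_linear (tassoc_bilinear1 _).
- move=> c s t /=; rewrite !(tlift_linear (tassoc_bilinear1 _)).
  by rewrite !scalerDr !scalerA mulrC addrACA.
- move=> v w; rewrite !(tliftE _ _ (tassoc_bilinear1 _)).
  by rewrite ((tens_bilinear _ _).2 w) ((tens_bilinear _ _).2 v).
Qed.

Lemma tassoc_linear : linear (@tassoc V W X).
Proof. exact: tlift_linear tassoc_bilinear. Qed.

Lemma tassocE v w x : tassoc ((v ⊗ₜ w) ⊗ₜ x) = (v ⊗ₜ (w ⊗ₜ x) : V ⊗ (W ⊗ X)).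
Proof.
by rewrite /tassoc (tliftE _ _ tassoc_bilinear) (tliftE _ _ (tassoc_bilinear1 x)).
Qed.

End TAssoc.

End TensorMaps.

(* [par b] is the projection of V = V_0 ⊕ V_1 onto V_b, where [false] is the
   even degree; v is homogeneous of degree b when [par b v = v]. *)
HB.mixin Record isSuperspace (F : fieldType) V of GRing.Lmodule F V := {
  par : bool -> V -> V;
  par_linear : forall b, linear (par b);
  par_par : forall b c v, par b (par c v) = if b == c then par c v else 0;
  par_sum : forall v, par false v + par true v = v }.

#[short(type="superspaceType")]
HB.structure Definition Superspace (F : fieldType) :=
  { V of isSuperspace F V & GRing.Lmodule F V }.

Section TensorSuper.
Variables (F : fieldType) (V W : superspaceType F).

Definition tens_par (b : bool) (t : V ⊗ W) : V ⊗ W :=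
  tmap (par false) (par b) t + tmap (par true) (par (~~ b)) t.

Lemma tens_par_linear b : linear (tens_par b).
Proof. by apply: linear_add; apply: tmap_linear; apply: par_linear. Qed.

Lemma tens_parE b v w :
  tens_par b (v ⊗ₜ w) =
    par false v ⊗ₜ par b w + par true v ⊗ₜ par (~~ b) w.
Proof. by rewrite /tens_par !tmapE //; apply: par_linear. Qed.

Let t0l (v : V) : v ⊗ₜ (0 : W) = 0.
Proof. exact: (lin_zero ((tens_bilinear V W).2 v)). Qed.
Let t0r (w : W) : (0 : V) ⊗ₜ w = 0.
Proof. exact: (lin_zero ((tens_bilinear V W).1 w)). Qed.

Lemma tens_par_par b c t :
  tens_par b (tens_par c t) = if b == c then tens_par c t else 0.
Proof.
move: t; apply: linear_ext.
- exact: (linear_comp (tens_par_linear b) (tens_par_linear c)).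
- case: (b == c); first exact: tens_par_linear.
  by move=> a x y; rewrite scaler0 addr0.
- move=> v w; rewrite !tens_parE (lin_add (tens_par_linear b)) !tens_parE.
  rewrite !par_par /= !t0r.
  by case: b; case: c => /=; rewrite ?t0l ?addr0 ?add0r.
Qed.

Lemma tens_par_sum t : tens_par false t + tens_par true t = t.
Proof.
move: t; apply: linear_ext => //.
- by apply: linear_add; apply: tens_par_linear.
- move=> v w; rewrite !tens_parE /= addrACA.
  rewrite -!(lin_add ((tens_bilinear V W).2 _)).
  rewrite [par true w + _]addrC !par_sum.
  by rewrite -(lin_add ((tens_bilinear V W).1 _)) par_sum.
Qed.

HB.instance Definition _ := isSuperspace.Build F (V ⊗ W)
  tens_par_linear tens_par_par tens_par_sum.

End TensorSuper.

(* Supercoalgebras; structure maps are even, F being in even degree. *)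
HB.mixin Record isSupercoalgebra (F : fieldType) C of Superspace F C := {
  comul : C -> C ⊗ C;
  counit : C -> F^o;
  comul_linear : linear comul;
  counit_linear : linear counit;
  comul_par : forall b x, comul (par b x) = par b (comul x);
  counit_par : forall x, counit (par true x) = 0;
  comulA : forall x,
    tassoc (tmap comul id (comul x)) = tmap id comul (comul x);
  counitl : forall x, tlift (fun y z : C => counit y *: z) (comul x) = x;
  counitr : forall x, tlift (fun y z : C => counit z *: y) (comul x) = x }.

#[short(type="supercoalgType")]
HB.structure Definition Supercoalgebra (F : fieldType) :=
  { C of isSupercoalgebra F C & Superspace F C }.

HB.mixin Record isSuperalgebra (F : fieldType) A
    of GRing.Algebra F A & Superspace F A := {
  one_par : par false (1 : A) = 1;
  mul_par : forall (b c : bool) (x y : A), par b x = x -> par c y = y ->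
    par (b (+) c) (x * y) = x * y }.

#[short(type="superalgType")]
HB.structure Definition Superalgebra (F : fieldType) :=
  { A of isSuperalgebra F A & GRing.Algebra F A & Superspace F A }.

(* The product of the superalgebra A ⊗ A, with the sign rule
   (x ⊗ y)(z ⊗ w) = (-1)^(|y||z|) xz ⊗ yw on homogeneous elements. *)
Definition tmul (F : fieldType) (A : superalgType F) (s t : A ⊗ A) : A ⊗ A :=
  tlift (fun x y => tlift (fun z w =>
    \sum_(b : bool) \sum_(c : bool)
      (-1) ^+ (b && c) *: ((x * par c z) ⊗ₜ (par b y * w))) t) s.

(* Supercommutative Hopf superalgebras, i.e. the coordinate superalgebras of
   affine group superschemes. In characteristic two supercommutativity would
   also require odd elements to square to zero. *)
HB.mixin Record isSuperHopf (F : fieldType) A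
    of Superalgebra F A & Supercoalgebra F A := {
  supercomm : forall (b c : bool) (x y : A), par b x = x -> par c y = y ->
    x * y = (-1) ^+ (b && c) *: (y * x);
  comul_one : comul (1 : A) = 1 ⊗ₜ 1;
  comul_mul : forall x y : A, comul (x * y) = tmul (comul x) (comul y);
  counit_one : counit (1 : A) = 1;
  counit_mul : forall x y : A, counit (x * y) = counit x * counit y;
  antipode : A -> A;
  antipode_linear : linear antipode;
  antipode_par : forall b x, antipode (par b x) = par b (antipode x);
  antipodel : forall x : A,
    tlift (fun y z : A => antipode y * z) (comul x) = (counit x)%:A;
  antipoder : forall x : A,
    tlift (fun y z : A => y * antipode z) (comul x) = (counit x)%:A }.

#[short(type="superHopfType")]
HB.structure Definition SuperHopf (F : fieldType) :=
  { A of isSuperHopf F A & Superalgebra F A & Supercoalgebra F A }.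

(* Right supercomodules. A representation of the group superscheme with
   coordinate superalgebra A is an A-supercomodule; only the coalgebra
   structure of A is involved, so after base change to K representations are
   supercomodules over the supercoalgebra A ⊗_F K ([bchange] below). *)
HB.mixin Record isSupercomodule (F : fieldType) (C : supercoalgType F) V
    of Superspace F V := {
  coact : V -> V ⊗ C;
  coact_linear : linear coact;
  coact_par : forall b v, coact (par b v) = par b (coact v);
  coactA : forall v, tassoc (tmap coact id (coact v)) = tmap id comul (coact v);
  coact_counit : forall v, tlift (fun (u : V) (c : C) => counit c *: u) (coact v) = v }.

#[short(type="supercomodType")]
HB.structure Definition Supercomodule (F : fieldType) (C : supercoalgType F) :=
  { V of isSupercomodule F C V & Superspace F V }.

Section Representations.
Variables (F : fieldType) (C : supercoalgType F).

Definition comod_hom (V W : supercomodType C) (f : {linear V -> W}) : Prop :=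
  (forall b v, f (par b v) = par b (f v)) /\
  (forall v, coact (f v) = tmap f id (coact v)).

Definition comod_iso (V W : supercomodType C) : Prop :=
  exists2 f : {linear V -> W}, comod_hom f & bijective f.

(* Graded subspaces U of V with coact(U) inside the image of U ⊗ C. *)
Definition subcomodule (V : supercomodType C) (U : V -> Prop) : Prop :=
  [/\ U 0,
      forall a u v, U u -> U v -> U (a *: u + v),
      forall b u, U u -> U (par b u) &
      forall u, U u -> exists s : seq (V * C),
        (forall p, p \in s -> U p.1) /\ coact u = \sum_(p <- s) p.1 ⊗ₜ p.2].

Definition irreducible (V : supercomodType C) : Prop :=
  (exists v : V, v <> 0) /\
  forall U : V -> Prop, subcomodule U ->
    (forall u, U u -> u = 0) \/ (forall v, U v).

End Representations.

(* Restriction of scalars along f : F -> K. *)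
Definition restr (F K : fieldType) (f : {rmorphism F -> K}) (M : Type) : Type := M.

Section Restriction.
Variables (F K : fieldType) (f : {rmorphism F -> K}).

HB.instance Definition _ (M : zmodType) := GRing.Zmodule.copy (restr f M) M.

Variable M : lmodType K.

Definition restr_scale (a : F) (x : restr f M) : restr f M := f a *: (x : M).

Lemma restr_scaleA a c x : restr_scale a (restr_scale c x) = restr_scale (a * c) x.
Proof. by rewrite /restr_scale rmorphM scalerA. Qed.

Lemma restr_scale1 : left_id 1 restr_scale.
Proof. by move=> x; rewrite /restr_scale rmorph1 scale1r. Qed.

Lemma restr_scaleDr : right_distributive restr_scale +%R.
Proof. by move=> a x y; rewrite /restr_scale scalerDr. Qed.

Lemma restr_scaleDl x : {morph restr_scale^~ x : a c / a + c}.
Proof. by move=> a c; rewrite /restr_scale rmorphD scalerDl. Qed.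

HB.instance Definition _ := GRing.Zmodule_isLmodule.Build F (restr f M)
  restr_scaleA restr_scale1 restr_scaleDr restr_scaleDl.

End Restriction.

(* The base change V ⊗_F K along f : F -> K, as a K-vector space. *)
Definition bchange (F K : fieldType) (f : {rmorphism F -> K}) (V : lmodType F) : Type :=
  V ⊗ restr f K^o.

Section BaseChange.
Variables (F K : fieldType) (f : {rmorphism F -> K}).

Section Module.
Variable V : lmodType F.

HB.instance Definition _ := GRing.Zmodule.copy (bchange f V) (V ⊗ restr f K^o).

Definition kmul (c : K) (x : restr f K^o) : restr f K^o := c * (x : K).

Lemma kmul_linear c : linear (kmul c).
Proof.
move=> a x y; rewrite /kmul mulrDr; congr (_ + _).
exact: mulrCA.
Qed.

Definition bscale (c : K) : bchange f V -> bchange f V :=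
  tmap (id : V -> V) (kmul c).

Lemma bscale_linear c : linear (bscale c : V ⊗ restr f K^o -> V ⊗ restr f K^o).
Proof. exact: tmap_linear (@linear_id _ V) (kmul_linear c). Qed.

Lemma bscaleE c (v : V) (x : restr f K^o) : bscale c (v ⊗ₜ x) = v ⊗ₜ kmul c x.
Proof. exact: tmapE (@linear_id _ V) (kmul_linear c) _ _. Qed.

Lemma bscaleA c d t : bscale c (bscale d t) = bscale (c * d) t.
Proof.
move: t; apply: (@linear_ext F V (restr f K^o) (V ⊗ restr f K^o)).
- exact: (linear_comp (bscale_linear c) (bscale_linear d)).
- exact: bscale_linear.
- by move=> v x; rewrite !bscaleE /kmul mulrA.
Qed.

Lemma bscale1 : left_id 1 bscale.
Proof.
apply: (@linear_ext F V (restr f K^o) (V ⊗ restr f K^o)) => //.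
- exact: bscale_linear.
- by move=> v x; rewrite !bscaleE /kmul mul1r.
Qed.

Lemma bscaleDr : right_distributive bscale +%R.
Proof. by move=> c; exact: (lin_add (bscale_linear c)). Qed.

Lemma bscaleDl t : {morph bscale^~ t : c d / c + d}.
Proof.
move=> c d; move: t; apply: (@linear_ext F V (restr f K^o) (V ⊗ restr f K^o)).
- exact: bscale_linear.
- by apply: linear_add; exact: bscale_linear.
- move=> v x; rewrite !bscaleE /kmul mulrDl.
  exact: (lin_add ((tens_bilinear V (restr f K^o)).2 v)).
Qed.

HB.instance Definition _ := GRing.Zmodule_isLmodule.Build K (bchange f V)
  bscaleA bscale1 bscaleDr bscaleDl.

Definition incl (v : V) : bchange f V := v ⊗ₜ (1 : restr f K^o).

Lemma tens_incl (v : V) (x : restr f K^o) :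
  (v ⊗ₜ x : bchange f V) = (x : K) *: incl v.
Proof. by rewrite /incl /GRing.scale /= bscaleE /kmul mulr1. Qed.

End Module.

Definition semilinear (V : lmodType F) (U : lmodType K) (g : V -> U) : Prop :=
  forall a u v, g (a *: u + v) = f a *: g u + g v.

(* The K-linear extension of an f-semilinear map. *)
Definition bext (V : lmodType F) (U : lmodType K) (g : V -> U) : bchange f V -> U :=
  tlift (fun (v : V) (x : restr f K^o) => (x : K) *: g v).

Lemma semi_add (V : lmodType F) (U : lmodType K) (g : V -> U) :
  semilinear g -> {morph g : x y / x + y}.
Proof. by move=> hg; exact: (@lin_add F V (restr f U) g hg). Qed.

Lemma semi_scale (V : lmodType F) (U : lmodType K) (g : V -> U) :
  semilinear g -> forall a v, g (a *: v) = f a *: g v.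
Proof. by move=> hg; exact: (@lin_scale F V (restr f U) g hg). Qed.

Section Semilinear.
Variables (V W : lmodType F) (U : lmodType K).

Lemma tlift_semi (b : V -> W -> U) :
  (forall w, semilinear (b^~ w)) -> (forall v, semilinear (b v)) ->
  semilinear (tlift b) /\ forall v w, tlift b (v ⊗ₜ w) = b v w.
Proof.
move=> h1 h2.
have hb : bilinear_map (b : V -> W -> restr f U) by [].
by split; [exact: (tlift_linear hb)|move=> v w; exact: (tliftE v w hb)].
Qed.

Lemma semi_ext (g h : V ⊗ W -> U) : semilinear g -> semilinear h ->
  (forall v w, g (v ⊗ₜ w) = h (v ⊗ₜ w)) -> g =1 h.
Proof. by move=> hg hh; apply: tensor_ext; exact: semi_add. Qed.

Lemma linear_semi (U' : lmodType K) (h : U -> U') (g : V -> U) :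
  linear h -> semilinear g -> semilinear (h \o g).
Proof. by move=> hh hg a u v /=; rewrite hg hh. Qed.

Lemma semi_comp (g : V -> U) (h : W -> V) :
  semilinear g -> linear h -> semilinear (g \o h).
Proof. by move=> hg hh a u v /=; rewrite hh hg. Qed.

End Semilinear.

Section Extension.
Variables (V : lmodType F) (U : lmodType K).

Lemma incl_semi : semilinear (@incl V).
Proof.
move=> a u v; rewrite -tens_incl /incl ((tens_bilinear V (restr f K^o)).1 1).
congr (_ + _).
transitivity (u ⊗ₜ (a *: (1 : restr f K^o))).
  by rewrite (lin_scale ((tens_bilinear V (restr f K^o)).2 u)).
congr (_ ⊗ₜ _); exact: mulr1.
Qed.

Section Bext.
Variables (g : V -> U) (hg : semilinear g).

Lemma bext_semi : semilinear (bext g : V ⊗ restr f K^o -> U) /\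
  forall v (x : restr f K^o), bext g (v ⊗ₜ x) = (x : K) *: g v.
Proof.
apply: (@tlift_semi V (restr f K^o) U) => [x|v] a u w.
- by rewrite hg scalerDr !scalerA mulrC.
- rewrite -[X in _ = X + _]/(f a *: ((u : K) *: g v)) scalerA -scalerDl; congr (_ *: _).
Qed.

Lemma bext_tens v (x : restr f K^o) : bext g (v ⊗ₜ x) = (x : K) *: g v.
Proof. exact: bext_semi.2. Qed.

Lemma bext_linear : linear (bext g).
Proof.
have hD : forall x y : bchange f V, bext g (x + y) = bext g x + bext g y.
  exact: (semi_add bext_semi.1).
have sD (c : K) : {morph *:%R c : x y / x + y :> bchange f V}.
  by move=> x y; rewrite scalerDr.
move=> c t u; rewrite hD; congr (_ + _).
move: t; apply: tensor_ext.
- by move=> x y; rewrite -hD -sD.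
- by move=> x y; rewrite -scalerDr -hD.
- move=> v x; rewrite bext_tens tens_incl !scalerA.
  by rewrite -(tens_incl v (c * (x : K))) bext_tens.
Qed.

Lemma bextE v : bext g (incl v) = g v.
Proof. by rewrite bext_tens scale1r. Qed.

End Bext.

Lemma bchange_ext (g h : bchange f V -> U) : linear g -> linear h ->
  (forall v, g (incl v) = h (incl v)) -> g =1 h.
Proof.
move=> hg hh e; apply: tensor_ext.
- exact: (lin_add hg).
- exact: (lin_add hh).
- by move=> v x; rewrite tens_incl (lin_scale hg) (lin_scale hh) e.
Qed.

End Extension.

(* The comparison map V ⊗_F W -> V_K ⊗_K W_K. *)
Definition bcomp (V W : lmodType F) : V ⊗ W -> bchange f V ⊗ bchange f W :=
  tlift (fun v w => incl v ⊗ₜ incl w).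

Section Bcomp.
Variables V W : lmodType F.

Let h : semilinear (@bcomp V W) /\
  forall v w, bcomp (v ⊗ₜ w) = (incl v ⊗ₜ incl w : bchange f V ⊗ bchange f W).
Proof.
apply: tlift_semi => [w|v].
- exact: (linear_semi ((tens_bilinear _ _).1 (incl w)) (@incl_semi V)).
- exact: (linear_semi ((tens_bilinear _ _).2 (incl v)) (@incl_semi W)).
Qed.

Lemma bcomp_semi : semilinear (@bcomp V W). Proof. exact: h.1. Qed.

Lemma bcompE v w :
  bcomp (v ⊗ₜ w) = (incl v ⊗ₜ incl w : bchange f V ⊗ bchange f W).
Proof. exact: h.2. Qed.

End Bcomp.

Section BchangeSuper.
Variable V : superspaceType F.

Definition bpar (b : bool) : bchange f V -> bchange f V :=
  bext (fun v => incl (par b v)).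

Lemma bpar_semi b : semilinear (fun v : V => incl (par b v)).
Proof. exact: (semi_comp (@incl_semi V) (par_linear b)). Qed.

Lemma bpar_linear b : linear (bpar b).
Proof. exact: (bext_linear (bpar_semi b)). Qed.

Lemma bparE b v : bpar b (incl v) = incl (par b v).
Proof. exact: (bextE (bpar_semi b)). Qed.

Lemma bpar_par b c t : bpar b (bpar c t) = if b == c then bpar c t else 0.
Proof.
move: t; apply: bchange_ext.
- exact: (linear_comp (bpar_linear b) (bpar_linear c)).
- case: (b == c); first exact: bpar_linear.
  by move=> a x y; rewrite scaler0 addr0.
- move=> v; rewrite !bparE par_par; case: (b == c) => //.
  exact: (lin_zero ((tens_bilinear V (restr f K^o)).1 1)).
Qed.

Lemma bpar_sum t : bpar false t + bpar true t = t.
Proof.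
move: t; apply: bchange_ext => //.
- by apply: linear_add; exact: bpar_linear.
- by move=> v; rewrite !bparE -(semi_add (@incl_semi V)) par_sum.
Qed.

HB.instance Definition _ := isSuperspace.Build K (bchange f V)
  bpar_linear bpar_par bpar_sum.

End BchangeSuper.

Lemma par_incl (V : superspaceType F) b (v : V) :
  par b (incl v) = incl (par b v).
Proof. exact: bparE. Qed.

Lemma par_bcomp (V W : superspaceType F) b (t : V ⊗ W) :
  par b (bcomp t) = bcomp (par b t).
Proof.
move: t; apply: semi_ext.
- exact: (linear_semi (par_linear b) (@bcomp_semi V W)).
- exact: (semi_comp (@bcomp_semi V W) (par_linear b)).
- move=> v w; rewrite bcompE.
  rewrite [LHS]tens_parE [par b (v ⊗ₜ w)]tens_parE.
  by rewrite (semi_add (@bcomp_semi V W)) !bcompE !par_incl.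
Qed.

(* The base change of rho : V -> V ⊗ W, sending v ⊗ x to x * (v_(0) ⊗ 1) ⊗ (v_(1) ⊗ 1). *)
Definition bcoact (V W : lmodType F) (rho : V -> V ⊗ W) :
  bchange f V -> bchange f V ⊗ bchange f W := bext (fun v => bcomp (rho v)).

Definition bcounit (C : supercoalgType F) : bchange f C -> K^o :=
  bext (fun c => f (counit c) : K^o).

Section Bcoact.
Variables (V W : lmodType F) (rho : V -> V ⊗ W) (hrho : linear rho).

Lemma bcoact_semi : semilinear (fun v => bcomp (rho v)).
Proof. exact: (semi_comp (@bcomp_semi V W) hrho). Qed.

Lemma bcoact_linear : linear (bcoact rho).
Proof. exact: (bext_linear bcoact_semi). Qed.

Lemma bcoactE v : bcoact rho (incl v) = bcomp (rho v).
Proof. exact: (bextE bcoact_semi). Qed.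

End Bcoact.

Lemma bcoact_par (V W : superspaceType F) (rho : V -> V ⊗ W) :
  linear rho -> (forall b v, rho (par b v) = par b (rho v)) ->
  forall b t, bcoact rho (par b t) = par b (bcoact rho t).
Proof.
move=> hrho hpar b; apply: bchange_ext.
- exact: (linear_comp (bcoact_linear hrho) (par_linear b)).
- exact: (linear_comp (par_linear b) (bcoact_linear hrho)).
- by move=> v /=; rewrite par_incl !bcoactE // hpar par_bcomp.
Qed.

Section BcoactA.
Variables (V W : lmodType F) (rho : V -> V ⊗ W) (delta : W -> W ⊗ W).
Hypotheses (hrho : linear rho) (hdelta : linear delta).

Let VK := bchange f V.
Let WK := bchange f W.

Let th1 : (V ⊗ W) ⊗ W -> (VK ⊗ WK) ⊗ WK :=
  tlift (fun t w => bcomp t ⊗ₜ incl w).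
Let th2 : V ⊗ (W ⊗ W) -> VK ⊗ (WK ⊗ WK) :=
  tlift (fun v s => incl v ⊗ₜ bcomp s).

Let h1 : semilinear th1 /\ forall t w, th1 (t ⊗ₜ w) = bcomp t ⊗ₜ incl w.
Proof.
apply: tlift_semi => [w|t].
- exact: (linear_semi ((tens_bilinear _ _).1 (incl w)) (@bcomp_semi V W)).
- exact: (linear_semi ((tens_bilinear _ _).2 (bcomp t)) (@incl_semi W)).
Qed.

Let h2 : semilinear th2 /\ forall v s, th2 (v ⊗ₜ s) = incl v ⊗ₜ bcomp s.
Proof.
apply: tlift_semi => [s|v].
- exact: (linear_semi ((tens_bilinear _ _).1 (bcomp s)) (@incl_semi V)).
- exact: (linear_semi ((tens_bilinear _ _).2 (incl v)) (@bcomp_semi W W)).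
Qed.

Let e1 (t : V ⊗ W) : tmap (bcoact rho) id (bcomp t) = th1 (tmap rho id t).
Proof.
have hr := bcoact_linear hrho; have hi := @linear_id _ WK.
move: t; apply: semi_ext.
- exact: (linear_semi (tmap_linear hr hi) (@bcomp_semi V W)).
- exact: (semi_comp h1.1 (tmap_linear hrho (@linear_id _ W))).
- move=> v w; rewrite bcompE (tmapE hr hi) (bcoactE hrho).
  by rewrite (tmapE hrho (@linear_id _ W)) h1.2.
Qed.

Let e2 (t : V ⊗ W) : tmap id (bcoact delta) (bcomp t) = th2 (tmap id delta t).
Proof.
have hr := bcoact_linear hdelta; have hi := @linear_id _ VK.
move: t; apply: semi_ext.
- exact: (linear_semi (tmap_linear hi hr) (@bcomp_semi V W)).
- exact: (semi_comp h2.1 (tmap_linear (@linear_id _ V) hdelta)).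
- move=> v w; rewrite bcompE (tmapE hi hr) (bcoactE hdelta).
  by rewrite (tmapE (@linear_id _ V) hdelta) h2.2.
Qed.

Let e3 (t : (V ⊗ W) ⊗ W) : tassoc (th1 t) = th2 (tassoc t).
Proof.
move: t; apply: semi_ext.
- exact: (linear_semi (@tassoc_linear _ _ _ _) h1.1).
- exact: (semi_comp h2.1 (@tassoc_linear _ _ _ _)).
move=> s w; rewrite h1.2.
have ht := (tens_bilinear (V ⊗ W) W).1 w.
move: s; apply: semi_ext.
- apply: (linear_semi (h := fun u => tassoc (u ⊗ₜ incl w)) _ (@bcomp_semi V W)).
  exact: (linear_comp (@tassoc_linear _ _ _ _) ((tens_bilinear _ _).1 (incl w))).
- apply: (semi_comp (h := fun u => tassoc (u ⊗ₜ w)) h2.1).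
  exact: (linear_comp (@tassoc_linear _ _ _ _) ht).
- by move=> v x; rewrite bcompE !tassocE h2.2 bcompE.
Qed.

Lemma bcoactA :
  (forall v, tassoc (tmap rho id (rho v)) = tmap id delta (rho v)) ->
  forall t, tassoc (tmap (bcoact rho) id (bcoact rho t)) =
            tmap id (bcoact delta) (bcoact rho t).
Proof.
move=> h.
have hr := bcoact_linear hrho; have hd := bcoact_linear hdelta.
have hi := @linear_id _ VK; have hj := @linear_id _ WK.
apply: bchange_ext.
- apply: (linear_comp (f := fun u => tassoc (tmap (bcoact rho) id u)) _ hr).
  exact: (linear_comp (@tassoc_linear _ _ _ _) (tmap_linear hr hj)).
- exact: (linear_comp (tmap_linear hi hd) hr).
- by move=> v; rewrite bcoactE // e1 e2 e3 h.
Qed.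

End BcoactA.

Section Bcounit.
Variable C : supercoalgType F.

Lemma bcounit_semi : semilinear (fun c : C => f (counit c) : K^o).
Proof.
by move=> a u v; rewrite (counit_linear a u v) rmorphD rmorphM.
Qed.

Lemma bcounit_linear : linear (@bcounit C).
Proof. exact: (bext_linear bcounit_semi). Qed.

Lemma bcounitE (c : C) : bcounit (incl c) = f (counit c).
Proof. exact: (bextE bcounit_semi). Qed.

Lemma bcounit_par t : @bcounit C (par true t) = 0.
Proof.
move: t; apply: bchange_ext.
- exact: (linear_comp bcounit_linear (par_linear true)).
- by move=> a x y; rewrite scaler0 addr0.
- by move=> c; rewrite par_incl bcounitE counit_par rmorph0.
Qed.

Lemma counitr_bilinear (E : fieldType) (D : lmodType E) (V : lmodType E)
    (e : D -> E^o) : linear e ->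
  bilinear_map (fun (v : V) (c : D) => e c *: v).
Proof.
move=> he; split=> [c|v] a x y /=; first by rewrite scalerDr !scalerA mulrC.
by rewrite he scalerDl scalerA.
Qed.

Lemma counitl_bilinear (E : fieldType) (D : lmodType E) (V : lmodType E)
    (e : D -> E^o) : linear e ->
  bilinear_map (fun (c : D) (v : V) => e c *: v).
Proof.
move=> he; split=> [v|c] a x y /=; first by rewrite he scalerDl scalerA.
by rewrite scalerDr !scalerA mulrC.
Qed.

Lemma bcoact_counit (V : lmodType F) (rho : V -> V ⊗ C) : linear rho ->
  (forall v, tlift (fun (u : V) (c : C) => counit c *: u) (rho v) = v) ->
  forall t, tlift (fun (u : bchange f V) (c : bchange f C) => bcounit c *: u)
              (bcoact rho t) = t.
Proof.
move=> hrho h.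
have hb := counitr_bilinear (bchange f V) bcounit_linear.
have hc := counitr_bilinear V (@counit_linear F C).
apply: bchange_ext => //.
- exact: (linear_comp (tlift_linear hb) (bcoact_linear hrho)).
move=> v; rewrite bcoactE // -[in RHS](h v).
move: (rho v); apply: semi_ext.
- exact: (linear_semi (tlift_linear hb) (@bcomp_semi V C)).
- exact: (semi_comp (@incl_semi V) (tlift_linear hc)).
- move=> u c; rewrite bcompE (tliftE _ _ hb) (tliftE _ _ hc) bcounitE.
  by rewrite (semi_scale (@incl_semi V)).
Qed.

Lemma bcomul_counit :
  forall t, tlift (fun u c : bchange f C => bcounit u *: c)
              (bcoact comul t) = t.
Proof.
have hrho := @comul_linear F C.
have hb := counitl_bilinear (bchange f C) bcounit_linear.
have hc := counitl_bilinear C (@counit_linear F C).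
apply: bchange_ext => //.
- exact: (linear_comp (tlift_linear hb) (bcoact_linear hrho)).
move=> v; rewrite bcoactE // -[in RHS](counitl v).
move: (comul v); apply: semi_ext.
- exact: (linear_semi (tlift_linear hb) (@bcomp_semi C C)).
- exact: (semi_comp (@incl_semi C) (tlift_linear hc)).
- move=> u c; rewrite bcompE (tliftE _ _ hb) (tliftE _ _ hc) bcounitE.
  by rewrite (semi_scale (@incl_semi C)).
Qed.

HB.instance Definition _ := isSupercoalgebra.Build K (bchange f C)
  (bcoact_linear (@comul_linear F C)) bcounit_linear
  (bcoact_par (@comul_linear F C) (@comul_par F C)) bcounit_par
  (bcoactA (@comul_linear F C) (@comul_linear F C) (@comulA F C))
  bcomul_counit (bcoact_counit (@comul_linear F C) (@counitr F C)).

Variable V : supercomodType C.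

HB.instance Definition _ := isSupercomodule.Build K (bchange f C) (bchange f V)
  (bcoact_linear (@coact_linear F C V))
  (bcoact_par (@coact_linear F C V) (@coact_par F C V))
  (bcoactA (@coact_linear F C V) (@comul_linear F C) (@coactA F C V))
  (bcoact_counit (@coact_linear F C V) (@coact_counit F C V)).

End Bcounit.

End BaseChange.

Section TmapTheory.
Variable F : fieldType.

Lemma tmap_comp (V W V' W' V'' W'' : lmodType F) (f : V' -> V'') (g : W' -> W'')
    (f' : V -> V') (g' : W -> W') :
  linear f -> linear g -> linear f' -> linear g' ->
  forall t, tmap f g (tmap f' g' t) = tmap (f \o f') (g \o g') t.
Proof.
move=> hf hg hf' hg'.
have hff := linear_comp hf hf'; have hgg := linear_comp hg hg'.
apply: linear_ext.
- exact: (linear_comp (tmap_linear hf hg) (tmap_linear hf' hg')).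
- exact: tmap_linear.
- by move=> v w; rewrite (tmapE hf' hg') (tmapE hf hg) (tmapE hff hgg).
Qed.

Lemma tassoc_nat (V W X V' W' X' : lmodType F) (f : V -> V') (g : W -> W')
    (h : X -> X') : linear f -> linear g -> linear h ->
  forall t, tassoc (tmap (tmap f g) h t) = tmap f (tmap g h) (tassoc t).
Proof.
move=> hf hg hh.
have hfg := tmap_linear hf hg; have hgh := tmap_linear hg hh.
have hfgh := tmap_linear hfg hh; have hfgh' := tmap_linear hf hgh.
have ha := @tassoc_linear F V W X; have ha' := @tassoc_linear F V' W' X'.
apply: linear_ext; [exact: linear_comp ha' hfgh|exact: linear_comp hfgh' ha|].
move=> s x.
have t1 := (tens_bilinear (V ⊗ W) X).1 x.
apply: (linear_ext (f := fun s => tassoc (tmap (tmap f g) h (s ⊗ₜ x)))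
                   (g := fun s => tmap f (tmap g h) (tassoc (s ⊗ₜ x)))).
- exact: (linear_comp (linear_comp ha' hfgh) t1).
- exact: (linear_comp (linear_comp hfgh' ha) t1).
- move=> v w; rewrite (tmapE hfg hh) (tmapE hf hg) !tassocE.
  by rewrite (tmapE hf hgh) (tmapE hg hh).
Qed.

End TmapTheory.

(* Even coalgebra morphisms. *)
Record coalg_mor (F : fieldType) (C D : supercoalgType F) := CoalgMor {
  cm_fun :> C -> D;
  cm_linear : linear cm_fun;
  cm_par : forall b x, cm_fun (par b x) = par b (cm_fun x);
  cm_comul : forall x, comul (cm_fun x) = tmap cm_fun cm_fun (comul x);
  cm_counit : forall x, counit (cm_fun x) = counit x }.

(* A C-supercomodule viewed as a D-supercomodule through C -> D. *)
Definition corestr (F : fieldType) (C D : supercoalgType F)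
  (phi : coalg_mor C D) (V : Type) : Type := V.

Section Corestriction.
Variables (F : fieldType) (C D : supercoalgType F) (phi : coalg_mor C D).

HB.instance Definition _ (V : superspaceType F) :=
  Superspace.copy (corestr phi V) V.

Variable V : supercomodType C.
Let hid := @linear_id F V.
Let hphi := cm_linear phi.
Let hidphi := tmap_linear hid hphi.

Definition corestr_coact (v : corestr phi V) : corestr phi V ⊗ D :=
  tmap (id : V -> V) phi (coact (v : V)).

Lemma corestr_linear : linear corestr_coact.
Proof. exact: (linear_comp hidphi (@coact_linear F C V)). Qed.

Lemma corestr_par b v : corestr_coact (par b v) = par b (corestr_coact v).
Proof.
rewrite /corestr_coact coact_par.
have hp := @tens_par_linear F V C b; have hp' := @tens_par_linear F V D b.
suff h t : tmap (id : V -> V) phi (tens_par b t) =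
           tens_par b (tmap (id : V -> V) phi t) by exact: h.
move: t; apply: linear_ext.
- exact: (linear_comp hidphi hp).
- exact: (linear_comp hp' hidphi).
- move=> u c; rewrite tens_parE (tmapE hid hphi) (lin_add hidphi).
  by rewrite !(tmapE hid hphi) tens_parE !cm_par.
Qed.

Lemma corestr_coactA v :
  tassoc (tmap corestr_coact id (corestr_coact v)) =
  tmap id comul (corestr_coact v).
Proof.
have hr := @coact_linear F C V; have hc := @comul_linear F C.
have hd := @comul_linear F D; have hic := @linear_id F C.
have hiD := @linear_id F D; have hpp := tmap_linear hphi hphi.
rewrite /corestr_coact.
rewrite (tmap_comp corestr_linear hiD hid hphi).
rewrite (tmap_comp hid hd hid hphi).
transitivity (tassoc (tmap (tmap (id : V -> V) phi) phi
                (tmap (@coact F C V) (id : C -> C) (coact (v : V))))).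
  by rewrite (tmap_comp hidphi hphi hr hic).
rewrite (tassoc_nat hid hphi hphi) coactA (tmap_comp hid hpp hid hc).
congr (tmap _ _ _); apply: funext => c; exact/esym/cm_comul.
Qed.

Lemma corestr_counit v :
  tlift (fun (u : corestr phi V) (c : D) => counit c *: u) (corestr_coact v) = v.
Proof.
have h := counitr_bilinear V (@counit_linear F C).
have h' := counitr_bilinear V (@counit_linear F D).
rewrite -[in RHS](coact_counit (v : V)) /corestr_coact.
move: (coact (v : V)); apply: linear_ext.
- exact: (linear_comp (tlift_linear h') hidphi).
- exact: tlift_linear h.
- by move=> u c; rewrite (tmapE hid hphi) (tliftE _ _ h') (tliftE _ _ h) cm_counit.
Qed.

HB.instance Definition _ := isSupercomodule.Build F D (corestr phi V)
  corestr_linear corestr_par corestr_coactA corestr_counit.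

End Corestriction.

(* The parity change: the same comodule with V_0 and V_1 exchanged. *)
Definition parity_change (V : Type) : Type := V.

Section ParityChange.
Variable F : fieldType.

HB.instance Definition _ (V : lmodType F) := GRing.Lmodule.copy (parity_change V) V.

Section Superspace.
Variable V : superspaceType F.

Definition pc_par (b : bool) (v : parity_change V) : parity_change V :=
  par (~~ b) (v : V).

Lemma pc_par_linear b : linear (pc_par b).
Proof. exact: (@par_linear F V (~~ b)). Qed.

Lemma pc_par_par b c v : pc_par b (pc_par c v) = if b == c then pc_par c v else 0.
Proof. by rewrite /pc_par par_par; case: b; case: c. Qed.

Lemma pc_par_sum v : pc_par false v + pc_par true v = v.
Proof. by rewrite addrC; exact: (@par_sum F V). Qed.

HB.instance Definition _ := isSuperspace.Build F (parity_change V)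
  pc_par_linear pc_par_par pc_par_sum.

End Superspace.

Variables (C : supercoalgType F) (V : supercomodType C).

Definition pc_coact (v : parity_change V) : parity_change V ⊗ C :=
  coact (v : V).

Lemma pc_coact_par b v : pc_coact (par b v) = par b (pc_coact v).
Proof.
rewrite /pc_coact [LHS](@coact_par F C V).
rewrite [LHS]/(tens_par (~~ b) (coact (v : V))) /tens_par negbK addrC.
by [].
Qed.

HB.instance Definition _ := isSupercomodule.Build F C (parity_change V)
  (@coact_linear F C V) pc_coact_par (@coactA F C V) (@coact_counit F C V).

End ParityChange.

Definition separable_over (F K : fieldType) (iota : {rmorphism F -> K}) (x : K) :=
  exists p : {poly F},
    [/\ irreducible_poly p, separable_poly p & root (map_poly iota p) x].

Definition is_separable_closure (F K : fieldType) (iota : {rmorphism F -> K}) :=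
  (forall x, separable_over iota x) /\
  (forall p : {poly K}, separable_poly p -> (1 < size p)%N ->
     exists x, root p x).

(* Gal(K / F); for K a separable closure, the absolute Galois group of F. *)
Record galois_group (F K : fieldType) (iota : {rmorphism F -> K}) := GaloisElt {
  gal_fun :> {rmorphism K -> K};
  gal_bij : bijective gal_fun;
  gal_fix : forall a, gal_fun (iota a) = iota a }.

Section Conjugate.
Variables (F K : fieldType) (iota : {rmorphism F -> K}).
Variable sigma : galois_group iota.

Section Twist.
Variable V : lmodType F.

Definition twist1 : bchange iota V -> bchange iota V :=
  tlift (fun (v : V) (x : restr iota K^o) => (sigma x : K) *: incl iota v).

Lemma twist1_semi0 : semilinear iota (twist1 : V ⊗ restr iota K^o -> bchange iota V) /\
  forall v (x : restr iota K^o), twist1 (v ⊗ₜ x) = (sigma x : K) *: incl iota v.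
Proof.
apply: tlift_semi => [x|v] a u w.
- by rewrite incl_semi scalerDr !scalerA mulrC.
- rewrite [sigma _](_ : _ = iota a * sigma u + sigma w).
    by rewrite scalerDl scalerA.
  by rewrite -[in RHS](gal_fix sigma) -rmorphM -rmorphD.
Qed.

Lemma twist1_incl v : twist1 (incl iota v) = incl iota v.
Proof. by rewrite twist1_semi0.2 rmorph1 scale1r. Qed.

Lemma twist1_semi : semilinear sigma twist1.
Proof.
have hD : forall x y : bchange iota V, twist1 (x + y) = twist1 x + twist1 y.
  exact: (semi_add twist1_semi0.1).
move=> c t u; rewrite hD; congr (_ + _); move: t; apply: tensor_ext.
- move=> x y; rewrite -hD; congr twist1; exact: (scalerDr c (x : bchange iota V)).
- by move=> x y; rewrite -scalerDr -hD.
- move=> v x; rewrite twist1_semi0.2 tens_incl !scalerA.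
  by rewrite -(tens_incl v (c * (x : K) : restr iota K^o)) twist1_semi0.2 rmorphM.
Qed.

(* The canonical isomorphism (V ⊗_(F,iota) K) ⊗_(K,sigma) K -> V ⊗_(F,iota) K,
   (v ⊗ x) ⊗ y |-> v ⊗ sigma(x) y. *)
Definition twist : bchange sigma (bchange iota V) -> bchange iota V :=
  bext twist1.

Lemma twist_linear : linear twist.
Proof. exact: bext_linear twist1_semi. Qed.

Lemma twistE v : twist (incl sigma (incl iota v)) = incl iota v.
Proof. by rewrite /twist bextE ?twist1_incl //; exact: twist1_semi. Qed.

Lemma twist_ext (U : lmodType K) (g h : bchange sigma (bchange iota V) -> U) :
  linear g -> linear h ->
  (forall v, g (incl sigma (incl iota v)) = h (incl sigma (incl iota v))) ->
  g =1 h.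
Proof.
move=> hg hh e; apply: bchange_ext => // t; move: t.
have hi := @incl_semi K K sigma (bchange iota V).
apply: (@bchange_ext F K iota V (restr sigma U)
          (fun t => g (incl sigma t)) (fun t => h (incl sigma t))) => //.
- exact: (linear_semi hg hi).
- exact: (linear_semi hh hi).
Qed.

End Twist.

Lemma twist_par (V : superspaceType F) b (t : bchange sigma (bchange iota V)) :
  twist (par b t) = par b (twist t).
Proof.
move: t; apply: twist_ext.
- exact: (linear_comp (@twist_linear V) (par_linear b)).
- exact: (linear_comp (par_linear b) (@twist_linear V)).
- by move=> v; rewrite !par_incl !twistE par_incl.
Qed.

Variable C : supercoalgType F.

Lemma twist_comul (t : bchange sigma (bchange iota C)) :
  comul (twist t) = tmap (@twist C) (@twist C) (comul t).
Proof.
have hl := @twist_linear C; have htt := tmap_linear hl hl.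
move: t; apply: twist_ext.
- exact: (linear_comp (@comul_linear _ _) hl).
- exact: (linear_comp htt (@comul_linear _ _)).
move=> c; rewrite twistE.
have hc := @comul_linear F C; have hc' := @comul_linear K (bchange iota C).
rewrite [comul (incl iota c)](bcoactE iota hc).
rewrite [comul (incl sigma _)](bcoactE sigma hc').
rewrite [comul (incl iota c)](bcoactE iota hc).
move: (comul c); apply: (semi_ext (@bcomp_semi _ _ iota C C)).
- have hs := @bcomp_semi _ _ sigma (bchange iota C) (bchange iota C).
  have hi := @bcomp_semi _ _ iota C C.
  move=> a u v; rewrite hi hs gal_fix htt //.
- by move=> x y; rewrite !bcompE (tmapE hl hl) !twistE.
Qed.

Lemma twist_counit (t : bchange sigma (bchange iota C)) :
  counit (twist t) = counit t.
Proof.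
move: t; apply: twist_ext.
- exact: (linear_comp (@counit_linear _ _) (@twist_linear C)).
- exact: (@counit_linear _ _).
move=> c; rewrite twistE.
rewrite [counit (incl sigma _)](bcounitE sigma) [counit (incl iota c)](bcounitE iota).
exact: (esym (gal_fix sigma (counit c))).
Qed.

Definition twist_mor : coalg_mor (bchange sigma (bchange iota C)) (bchange iota C) :=
  CoalgMor (@twist_linear C) (@twist_par C) twist_comul twist_counit.

(* The base change of W along sigma, made a comodule over C ⊗_F K again. *)
Definition conjugate (W : supercomodType (bchange iota C)) :
    supercomodType (bchange iota C) :=
  corestr twist_mor (bchange sigma W).

End Conjugate.

(* Main.v *)
Require Import Defs.
From HB Require Import structures.
From mathcomp Require Import all_boot all_algebra all_field.
From mathcomp Require Import boolp classical_sets.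
Import GRing.Theory.
Local Open Scope ring_scope.

(** Let K be the separable closure of F and C the coordinate coalgebra. A
comodule is handled through the operators f.v = (id ⊗ f)(coact v), f running
over the linear functionals on C: subcomodules are the graded subspaces stable
under these operators, homomorphisms the even linear maps commuting with them,
and over C ⊗ K the K-linear extensions of functionals on C suffice.

An element of V' ⊂ V_K that is a combination of as few elements of K as possible
provides an F-linear embedding e : V -> V' of representations, because V is
irreducible. If V ≅ Π V, let T : V' -> V_K be the inclusion followed by the
induced odd automorphism of V_K, and E : V_K -> V' the K-linear extension of e.
The elements killed by all E ∘ (1 ⊗ sigma) form a Galois stable subspace of V_K
which meets V trivially, hence is zero by Galois descent. So some
E ∘ (1 ⊗ sigma) ∘ T is nonzero; it is odd and sigma-semilinear, and bijective by
Schur's lemma. Conversely, an odd semilinear automorphism psi of V' yields, for a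
suitable F-linear lam : K -> F, a nonzero odd endomorphism
(1 ⊗ lam) ∘ psi ∘ e of V. *)

Set Implicit Arguments.
Unset Strict Implicit.
Unset Printing Implicit Defensive.
Local Open Scope classical_set_scope.

(** * Galois theory of the separable closure *)

Lemma minimal_annihilator (E K : fieldType) (i : {rmorphism E -> K}) (x : K)
    (p : {poly E}) : p != 0 -> root (map_poly i p) x ->
  exists m : {poly E}, [/\ m != 0, root (map_poly i m) x &
    forall q, root (map_poly i q) x -> m %| q].
Proof.
move=> p0 px.
pose P n := `[< exists q : {poly E},
  [/\ q != 0, size q = n & root (map_poly i q) x] >].
have exP : exists n, P n by exists (size p); apply/asboolP; exists p.
case: (ex_minnP exP) => n /asboolP[m [m0 sm mx]] minm.
exists m; split=> // q qx; apply/modp_eq0P/eqP; apply: contraT => r0.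
have rx : root (map_poly i (q %% m)) x.
  move: qx; rewrite {1}(divp_eq q m) rmorphD rmorphM /= /root !hornerE.
  by rewrite (eqP mx) mulr0 add0r.
have /minm : P (size (q %% m)) by apply/asboolP; exists (q %% m).
by rewrite -sm leqNgt ltn_modp m0.
Qed.

Lemma annihilator_size (E K : fieldType) (i : {rmorphism E -> K}) (x : K)
    (m : {poly E}) : m != 0 -> root (map_poly i m) x -> (1 < size m)%N.
Proof.
by move=> m0 mx; rewrite -(size_map_poly i) (root_size_gt1 _ mx) ?map_poly_eq0.
Qed.

Section Galois.
Variables (F K : fieldType) (iota : {rmorphism F -> K}).
Hypothesis hsep : is_separable_closure iota.

Lemma inverse_as_polynomial (z : K) : z != 0 ->
  exists r : {poly F}, (map_poly iota r).[z] * z = 1.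
Proof.
move=> z0; have [p [irp _ pz]] := hsep.1 z.
have cop : coprimep p 'X.
  rewrite irreducible_poly_coprime //; apply/negP => /dvdpP[q Xq].
  case/negP: z0; rewrite -[z]hornerX -(map_polyX iota) Xq rmorphM /= hornerM.
  by rewrite (eqP pz) mulr0.
have /Bezout_coprimepP[[u v]] := cop.
rewrite -size_poly_eq1 => /size_poly1P[c c0 e].
exists (c^-1 *: v).
have := congr1 (fun q => (map_poly iota q).[z]) e.
rewrite /= rmorphD !rmorphM /= map_polyC map_polyX !hornerE (eqP pz) mulr0 add0r.
by move=> e'; rewrite map_polyZ hornerZ -mulrA e' -rmorphM mulVf // rmorph1.
Qed.

(* Graphs of the F-embeddings into K of intermediate fields of K/F. *)
Definition embedding_graph (G : K * K -> Prop) : Prop :=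
  [/\ forall a, G (iota a, iota a),
      forall u v, G u -> G v -> G (u - v),
      forall u v, G u -> G v -> G (u * v) &
      forall y, G (0, y) -> y = 0].

Record embedding := Embedding {
  graph :> K * K -> Prop;
  graphP : embedding_graph graph }.

Section Embedding.
Variable G : embedding.

Let Gc a : G (iota a, iota a). Proof. by have [h _ _ _] := graphP G. Qed.
Let GB u v : G u -> G v -> G (u - v).
Proof. by have [_ h _ _] := graphP G; apply: h. Qed.
Let GM u v : G u -> G v -> G (u * v).
Proof. by have [_ _ h _] := graphP G; apply: h. Qed.
Let G0 y : G (0, y) -> y = 0. Proof. by have [_ _ _ h] := graphP G; apply: h. Qed.
Let GD u v : G u -> G v -> G (u + v).
Proof.
move=> hu hv; rewrite -[v]opprK; apply: GB => //; rewrite -sub0r; apply: GB => //.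
by have := Gc 0; rewrite rmorph0.
Qed.

Lemma graph_horner (r : {poly F}) u : G u ->
  G ((map_poly iota r).[u.1], (map_poly iota r).[u.2]).
Proof.
move=> hu; elim/poly_ind: r => [|r c ih].
  by rewrite rmorph0 !horner0; have := Gc 0; rewrite rmorph0.
rewrite rmorphD rmorphM /= map_polyC map_polyX !hornerE.
exact: (GD (GM ih hu) (Gc c)).
Qed.

Lemma graph_fun x y z : G (x, y) -> G (x, z) -> y = z.
Proof.
move=> hy hz; apply/eqP; rewrite -subr_eq0; apply/eqP/G0.
by have h : G (x - x, y - z) := GB hy hz; rewrite subrr in h.
Qed.

Definition domain : {pred K} := fun x => `[< exists y, G (x, y) >].

Lemma domain_divring : divring_closed domain.
Proof.
have inv x : x \in domain -> x^-1 \in domain.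
  have [->|x0] := eqVneq x 0; first by rewrite invr0.
  move=> /asboolP[y hy]; have [r hr] := inverse_as_polynomial x0.
  apply/asboolP; exists (map_poly iota r).[y].
  have -> : x^-1 = (map_poly iota r).[x] by apply: (mulIf x0); rewrite mulVf // hr.
  exact: (graph_horner r hy).
split.
- by apply/asboolP; exists 1; have := Gc 1; rewrite rmorph1.
- move=> x x' /asboolP[y hy] /asboolP[y' hy']; apply/asboolP.
  by exists (y - y'); exact: (GB hy hy').
- move=> x x' /asboolP[y hy] /inv/asboolP[y' hy']; apply/asboolP.
  by exists (y * y'); exact: (GM hy hy').
Qed.

HB.instance Definition _ := GRing.isDivringClosed.Build K domain domain_divring.

Definition dom_field := {x : K | x \in domain}.
HB.instance Definition _ := SubType.on dom_field.
HB.instance Definition _ := Choice.on dom_field.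
HB.instance Definition _ := [SubChoice_isSubIntegralDomain of dom_field by <:].
HB.instance Definition _ := [SubIntegralDomain_isSubField of dom_field by <:].

Definition dom_embed (x : dom_field) : K := sval (cid (asboolW (valP x))).

Lemma dom_embedP x : G (val x, dom_embed x).
Proof. exact: svalP (cid (asboolW (valP x))). Qed.

Lemma dom_embed_zmod : zmod_morphism dom_embed.
Proof.
move=> x y; apply: (graph_fun (dom_embedP _)).
rewrite rmorphB; exact: (GB (dom_embedP x) (dom_embedP y)).
Qed.

Lemma dom_embed_monoid : monoid_morphism dom_embed.
Proof.
split=> [|x y]; apply: (graph_fun (dom_embedP _)).
  by rewrite rmorph1; have := Gc 1; rewrite rmorph1.
rewrite rmorphM; exact: (GM (dom_embedP x) (dom_embedP y)).
Qed.

HB.instance Definition _ := GRing.isZmodMorphism.Build dom_field K dom_embed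
  dom_embed_zmod.
HB.instance Definition _ := GRing.isMonoidMorphism.Build dom_field K dom_embed
  dom_embed_monoid.

Lemma dom_lift a b : G (a, b) -> exists c : dom_field, val c = a /\ dom_embed c = b.
Proof.
move=> hab; have ha : a \in domain by apply/asboolP; exists b.
exists (exist _ a ha); split=> //.
by apply: (graph_fun (x := a)) => //; exact: (dom_embedP (exist _ a ha)).
Qed.

(* The graph of the extension to E(x) of the embedding of E with graph G. *)
Definition adjoin_graph (x y : K) : K * K -> Prop := fun u =>
  exists q : {poly dom_field}, u = ((map_poly val q).[x], (map_poly dom_embed q).[y]).

Lemma adjoin_graph_embedding x y :
  (forall q, root (map_poly (val : dom_field -> K) q) x ->
     root (map_poly dom_embed q) y) ->
  embedding_graph (adjoin_graph x y).
Proof.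
move=> h; split.
- move=> a; have [c [cv ce]] := dom_lift (Gc a).
  by exists c%:P; rewrite !map_polyC !hornerC /= -[X in (X, _)]cv -ce.
- move=> _ _ [q ->] [r ->]; exists (q - r).
  by rewrite !rmorphB /= !hornerE.
- move=> _ _ [q ->] [r ->]; exists (q * r).
  by rewrite !rmorphM /= !hornerE.
- move=> z [q [qx ->]]; apply/eqP/h; by rewrite /root -qx.
Qed.

Lemma graph_adjoin x y u : G u -> adjoin_graph x y u.
Proof.
case: u => a b /dom_lift[c [<- <-]].
by exists c%:P; rewrite !map_polyC !hornerC.
Qed.

Lemma adjoin_graph_gen x y : adjoin_graph x y (x, y).
Proof. by exists 'X; rewrite !map_polyX !hornerX. Qed.

Lemma embedding_step x : exists y, embedding_graph (adjoin_graph x y).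
Proof.
have [p [irp sp px]] := hsep.1 x.
have pK (c : F) : iota c \in domain by apply/asboolP; exists (iota c).
pose lift (c : F) : dom_field := exist _ (iota c) (pK c).
have lz : zmod_morphism lift.
  by move=> a b; apply: val_inj; rewrite rmorphB /= rmorphB.
have lm : monoid_morphism lift.
  by split=> [|a b]; apply: val_inj; rewrite /= ?rmorph1 // rmorphM.
pose lr : {rmorphism F -> dom_field} := HB.pack lift
  (GRing.isZmodMorphism.Build F dom_field lift lz)
  (GRing.isMonoidMorphism.Build F dom_field lift lm).
have px' : root (map_poly (val : dom_field -> K) (map_poly lr p)) x.
  by rewrite -map_poly_comp.
have p0 : map_poly lr p != 0 by rewrite map_poly_eq0 separable_poly_neq0.
have [m [m0 mx mdvd]] := minimal_annihilator p0 px'.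
have ms : separable_poly m.
  by apply: (dvdp_separable (mdvd _ px')); rewrite separable_map.
have [] := hsep.2 (map_poly dom_embed m).
- by rewrite separable_map.
- by rewrite size_map_poly (annihilator_size m0 mx).
move=> y my; exists y; apply: adjoin_graph_embedding => q /mdvd/dvdpP[r ->].
by rewrite rmorphM rootM my orbT.
Qed.

End Embedding.

Lemma embedding_surj (s : {rmorphism K -> K}) :
  (forall a, s (iota a) = iota a) -> bijective s.
Proof.
move=> sF; suff sur y : exists x, s x = y.
  exists (fun y => sval (cid (sur y))) => x; last exact: svalP (cid (sur x)).
  by apply: (fmorph_inj s); exact: svalP (cid (sur (s x))).
have [p [irp sp py]] := hsep.1 y.
have sroot k : root (map_poly iota p) (iter k s y).
  elim: k => [//|k ih]; rewrite iterS.
  have -> : map_poly iota p = map_poly s (map_poly iota p).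
    by rewrite -map_poly_comp; apply: eq_map_poly => a; rewrite /= sF.
  by rewrite fmorph_root.
have p0 : map_poly iota p != 0 by rewrite map_poly_eq0 separable_poly_neq0.
have : ~~ uniq (traject s y (size (map_poly iota p)).+1).
  apply/negP => /(max_poly_roots p0); rewrite size_traject ltnNge leqnSn => h.
  by apply/notF/h/allP => _ /trajectP[k _ ->].
rewrite looping_uniq negbK => /trajectP[k lt_k].
rewrite -(subnKC (ltnW lt_k)) iterD; move: lt_k; rewrite -subn_gt0.
case: (_ - k)%N => // d _ e; exists (iter d s y); symmetry.
by elim: k e => [//|k ih] /= /fmorph_inj.
Qed.

Lemma embedding_extends (G0 : K * K -> Prop) : embedding_graph G0 ->
  exists sigma : galois_group iota, forall x y, G0 (x, y) -> sigma x = y.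
Proof.
move=> hG0; pose P (G : set (K * K)) := G = set0 \/ embedding_graph G /\ G0 `<=` G.
have [] := @Zorn_bigcup _ P.
  move=> Fam FP tot.
  have [[X0 FX0 X00]|none] := pselect (exists2 X, Fam X & X <> set0); last first.
    left; apply/seteqP; split=> // u [X FX Xu]; apply: none; exists X => // X0.
    by rewrite X0 in Xu.
  have [//|[[g1 _ _ _] g0]] := FP _ FX0.
  right; split; last by move=> u /g0; exists X0.
  have pick u v X Y : Fam X -> Fam Y -> X u -> Y v ->
      exists Z, [/\ Fam Z, embedding_graph Z, Z u & Z v].
    move=> FX FY Xu Yv.
    have gr Z w : Fam Z -> Z w -> embedding_graph Z.
      by move=> FZ Zw; case: (FP _ FZ) => [Z0|[]] //; rewrite Z0 in Zw.
    have [XY|YX] := tot _ _ FX FY.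
    - by exists Y; split; [|exact: gr Yv|exact: XY|].
    - by exists X; split; [|exact: gr Xu| |exact: YX].
  split.
  - by move=> a; exists X0.
  - move=> u v [X FX Xu] [Y FY Yv].
    by have [Z [FZ [_ h _ _] Zu Zv]] := pick _ _ _ _ FX FY Xu Yv;
      exists Z => //; apply: h.
  - move=> u v [X FX Xu] [Y FY Yv].
    by have [Z [FZ [_ _ h _] Zu Zv]] := pick _ _ _ _ FX FY Xu Yv;
      exists Z => //; apply: h.
  - move=> y [X FX Xu].
    by have [Z [FZ [_ _ _ h] Zu _]] := pick _ _ _ _ FX FX Xu Xu; apply: h.
move=> G [PG maxG].
have {PG} [hG G0G] : embedding_graph G /\ G0 `<=` G.
  case: PG => // G_0; case: (maxG G0); last by right; split.
  rewrite G_0; split=> // h; have [h1 _ _ _] := hG0; exact: (h _ (h1 0)).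
pose g := Embedding hG.
have dom x : exists y, G (x, y).
  have [y hy] := embedding_step g x; exists y; apply: contrapT => nG.
  apply: (maxG (adjoin_graph g x y)).
    split; last by move=> h; apply/nG/h; exact: adjoin_graph_gen.
    by move=> u; exact: (@graph_adjoin g).
  right; split=> // u /G0G; exact: (@graph_adjoin g).
pose s x := sval (cid (dom x)).
have sP x : G (x, s x) := svalP (cid (dom x)).
have sE x y : G (x, y) -> s x = y := @graph_fun g _ _ _ (sP x).
have [Gc GB GM _] := hG.
have sz : zmod_morphism s by move=> x y; apply: sE; exact: (GB _ _ (sP x) (sP y)).
have sm : monoid_morphism s.
  split=> [|x y]; apply: sE; last exact: (GM _ _ (sP x) (sP y)).
  by have := Gc 1; rewrite rmorph1.
pose sr : {rmorphism K -> K} := HB.pack s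
  (GRing.isZmodMorphism.Build K K s sz) (GRing.isMonoidMorphism.Build K K s sm).
have sF a : sr (iota a) = iota a by apply: sE.
by exists (GaloisElt (embedding_surj sF) sF) => x y /G0G; exact: sE.
Qed.

Lemma fixed_field (x : K) :
  (forall sigma : galois_group iota, sigma x = x) -> exists a, x = iota a.
Proof.
move=> xfix; have [p [irp sp px]] := hsep.1 x.
have [m [m0 mx mdvd]] := minimal_annihilator (separable_poly_neq0 sp) px.
have ms : separable_poly (map_poly iota m).
  by rewrite separable_map; apply: dvdp_separable (mdvd _ px) sp.
have [r mr] := factor_theorem _ _ mx.
have [s2|s2] := leqP (size m) 2.
  have s2' : size m = 2%N.
    by apply/eqP; rewrite eqn_leq s2; exact: annihilator_size m0 mx.
  exists (- m`_0 / m`_1).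
  have m1 : iota m`_1 != 0.
    by rewrite fmorph_eq0 -[1%N]/(2.-1) -s2' -lead_coefE lead_coef_eq0.
  move: mx; rewrite /root horner_coef size_map_poly s2' !big_ord_recl big_ord0.
  rewrite !coef_map /= expr0 mulr1 addr0 expr1 addrC addr_eq0 => /eqP e.
  by rewrite fmorph_div rmorphN -e mulrC mulKf.
have [] := hsep.2 r.
- by apply: dvdp_separable ms; rewrite mr dvdp_mulr.
- move: s2; rewrite -(size_map_poly iota) mr size_Mmonic ?monicXsubC //.
    by rewrite size_XsubC addn2 /=; case: (size r) => [|[]].
  by apply: contraTneq m0 => r0; rewrite -(map_poly_eq0 iota) mr r0 mul0r eqxx.
move=> y ry; have yx : y != x.
  by apply: contraTneq ry => ->; move: ms; rewrite mr separable_root => /andP[].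
pose G0 (u : K * K) := exists q : {poly F},
  u = ((map_poly iota q).[x], (map_poly iota q).[y]).
have [|sigma hs] := @embedding_extends G0.
  split.
  - by move=> a; exists a%:P; rewrite map_polyC !hornerC.
  - by move=> _ _ [q ->] [t ->]; exists (q - t); rewrite rmorphB /= !hornerE.
  - by move=> _ _ [q ->] [t ->]; exists (q * t); rewrite rmorphM /= !hornerE.
  - move=> z [q [qx ->]].
    have /mdvd/dvdpP[t ->] : root (map_poly iota q) x by rewrite /root -qx.
    by rewrite rmorphM /= mr !hornerM (eqP ry) mul0r mulr0.
case/eqP: yx; rewrite -[RHS](xfix sigma); symmetry; apply: hs.
by exists 'X; rewrite map_polyX !hornerX.
Qed.

End Galois.

(** * Tensors and functionals *)

Definition subspace (F : fieldType) (V : lmodType F) (U : V -> Prop) : Prop :=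
  U 0 /\ forall a u v, U u -> U v -> U (a *: u + v).

Section Subspace.
Variables (F : fieldType) (V : lmodType F) (U : V -> Prop) (hU : subspace U).

Lemma subspaceZ a u : U u -> U (a *: u).
Proof. by move=> hu; rewrite -[_ *: _]addr0; apply: hU.2 => //; exact: hU.1. Qed.

Lemma subspaceB u v : U u -> U v -> U (u - v).
Proof. by move=> hu hv; rewrite addrC -scaleN1r; apply: hU.2. Qed.

End Subspace.

Lemma subspace0 (F : fieldType) (V : lmodType F) : subspace (fun v : V => v = 0).
Proof. by split=> // a _ _ -> ->; rewrite scaler0 addr0. Qed.

Lemma lin_sub (F : fieldType) (U V : lmodType F) (f : U -> V) :
  linear f -> {morph f : x y / x - y}.
Proof. by move=> hf x y; rewrite addrC -scaleN1r hf scaleN1r addrC. Qed.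

Lemma semi_zero (F K : fieldType) (f : {rmorphism F -> K}) (V : lmodType F)
    (U : lmodType K) (g : V -> U) : Defs.semilinear f g -> g 0 = 0.
Proof. by move=> hg; exact: (@lin_zero F V (restr f U) g hg). Qed.

Section Functionals.
Variables (F : fieldType) (C : lmodType F).

Lemma functional_exists (W : C -> Prop) (x : C) : subspace W -> ~ W x ->
  exists f : C -> F^o, [/\ linear f, f x = 1 & forall w, W w -> f w = 0].
Proof.
move=> hW nWx; pose P (A : set C) := A = set0 \/ [/\ subspace A, W `<=` A & ~ A x].
have [] := @Zorn_bigcup _ P.
  move=> Fam FP tot.
  have [[X0 FX0 X00]|none] := pselect (exists2 X, Fam X & X <> set0); last first.
    left; apply/seteqP; split=> // u [X FX Xu]; apply: none; exists X => // X0.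
    by rewrite X0 in Xu.
  have sub X u : Fam X -> X u -> [/\ subspace X, W `<=` X & ~ X x].
    by move=> FX Xu; case: (FP _ FX) => // X1; rewrite X1 in Xu.
  have [//|[[g1 _] g0 _]] := FP _ FX0.
  right; split.
  - split=> [|a u v [X FX Xu] [Y FY Yv]]; first by exists X0.
    have [XY|YX] := tot _ _ FX FY.
    + by exists Y => //; have [[_ h] _ _] := sub _ _ FY Yv; apply: h => //; exact: XY.
    + by exists X => //; have [[_ h] _ _] := sub _ _ FX Xu; apply: h => //; exact: YX.
  - by move=> u /g0; exists X0.
  - by move=> [X FX Xx]; have [_ _] := sub _ _ FX Xx.
move=> A [PA maxA].
have {PA} [hA WA nAx] : [/\ subspace A, W `<=` A & ~ A x].
  case: PA => // A0; case: (maxA W); last by right; split.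
  by rewrite A0; split=> // h; exact: (h _ hW.1).
have ex v : exists a : F, A (v - a *: x).
  apply: contrapT => nv.
  apply: (maxA (fun u => exists a, A (u - a *: v))).
    split=> [u Au|h]; first by exists 0; rewrite scale0r subr0.
    by apply: nv; exists 0; rewrite scale0r subr0; apply: h; exists 1;
      rewrite scale1r subrr; exact: hA.1.
  right; split.
  - split; first by exists 0; rewrite scale0r subr0; exact: hA.1.
    move=> c u w [a ha] [b hb]; exists (c * a + b).
    rewrite scalerDl -scalerA opprD addrACA -scalerBr; exact: hA.2.
  - by move=> u Wu; exists 0; rewrite scale0r subr0; exact: WA.
  - move=> [a ha]; have [a0|a0] := eqVneq a 0.
      by apply: nAx; rewrite a0 scale0r subr0 in ha.
    apply: nv; exists a^-1.
    rewrite -[v in A (v - _)](scalerK a0) -scalerBr -opprB scalerN -scaleNr.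
    exact: subspaceZ.
have uniqA v a b : A (v - a *: x) -> A (v - b *: x) -> a = b.
  move=> ha hb; apply: contrapT => /eqP; rewrite -subr_eq0 => ab; apply: nAx.
  rewrite -(scalerK ab x); apply: subspaceZ => //.
  have := subspaceB hA hb ha; rewrite addrC opprB addrA subrK.
  by rewrite -scalerBl.
pose f v : F^o := sval (cid (ex v)).
have fP v : A (v - f v *: x) := svalP (cid (ex v)).
exists f; split.
- move=> a u v; apply: (uniqA (a *: u + v)) => //.
  rewrite scalerDl -scalerA opprD addrACA -scalerBr; exact: hA.2.
- by apply: (uniqA x) => //; rewrite scale1r subrr; exact: hA.1.
- by move=> w /WA Aw; apply: (uniqA w) => //; rewrite scale0r subr0.
Qed.

Fixpoint lspan (s : seq C) (c : C) : Prop :=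
  if s is d :: s' then exists a : F, lspan s' (c - a *: d) else c = 0.

Lemma lspan_subspace s : subspace (lspan s).
Proof.
elim: s => [|d s [ih0 ihD]] /=; first exact: subspace0.
split; first by exists 0; rewrite scale0r subr0.
move=> c u w [a ha] [b hb]; exists (c * a + b).
rewrite scalerDl -scalerA opprD addrACA -scalerBr; exact: ihD.
Qed.

Lemma lspan_mem s c : c \in s -> lspan s c.
Proof.
elim: s => [//|d s ih]; rewrite inE => /orP[/eqP->|/ih hc] /=.
  by exists 1; rewrite scale1r subrr; exact: (lspan_subspace s).1.
by exists 0; rewrite scale0r subr0.
Qed.

End Functionals.

Section Balanced.
Variables (F : fieldType) (W C : lmodType F).

Definition balanced (M : zmodType) (b : W -> C -> M) : Prop :=
  [/\ forall c, {morph b^~ c : u v / u + v},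
      forall w, {morph b w : u v / u + v} &
      forall a w c, b (a *: w) c = b w (a *: c)].

(* Equality of formal sums in W ⊗ C, tested on all balanced maps. *)
Definition same_tensor (s t : seq (W * C)) : Prop :=
  forall (M : zmodType) (b : W -> C -> M), balanced b -> fsum b s = fsum b t.

Lemma balanced_contract (f : C -> F^o) :
  linear f -> balanced (fun w c => f c *: w).
Proof.
move=> hf; split=> [c u v|w c d|a w c]; first exact: scalerDr.
  by rewrite (lin_add hf) scalerDl.
by rewrite (lin_scale hf) scalerA mulrC.
Qed.

Lemma same_tensor_absorb (s : seq (W * C)) w c : lspan (map snd s) c ->
  exists s', size s' = size s /\ same_tensor ((w, c) :: s) s'.
Proof.
elim: s c => [|[u d] s ih] c /=.
  move=> ->; exists [::]; split=> // M b [_ bD _]; rewrite /fsum big_seq1 big_nil /=.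
  by apply: (addrI (b w 0)); rewrite -bD !addr0.
move=> [a /ih[s' [sz e]]]; exists ((u + a *: w, d) :: s'); split; first by rewrite /= sz.
move=> M b hb; have [bDl bDr bZ] := hb; have := e M b hb.
rewrite /fsum !big_cons /= => <-; rewrite bDl bZ -!addrA [LHS]addrCA; congr (_ + _).
by rewrite addrA -bDr [a *: d + _]addrC subrK.
Qed.

Lemma same_tensor_sub (U : W -> Prop) (s : seq (W * C)) : subspace U ->
  (forall f : C -> F^o, linear f -> U (fsum (fun w c => f c *: w) s)) ->
  exists s', (forall p, p \in s' -> U p.1) /\ same_tensor s s'.
Proof.
move=> hU; have [n] := ubnP (size s); elim: n s => [//|n ih] [|[w c] s] /= sz hs.
  by exists [::].
have [hc|hc] := pselect (lspan (map snd s) c).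
  have [s' [sz' e]] := same_tensor_absorb w hc.
  have [] := ih s'; first by rewrite sz'.
    by move=> f hf; rewrite -(e _ _ (balanced_contract hf)); exact: hs.
  move=> t [tU te]; exists t; split=> // M b hb; rewrite (e M b hb); exact: te.
have [f [hf f1 f0]] := functional_exists (lspan_subspace _) hc.
have Uw : U w.
  have := hs f hf; rewrite /fsum big_cons /= f1 scale1r big1_seq ?addr0 //.
  move=> p /andP[_ ps]; rewrite f0 ?scale0r //; apply: lspan_mem.
  by apply/mapP; exists p.
have [//||t [tU te]] := ih s.
  move=> g hg; have := hs g hg; rewrite /fsum big_cons /= => h.
  rewrite -[\sum_(p <- s) _](addKr (g c *: w)) addrC; apply: subspaceB => //.
  exact: subspaceZ.
exists ((w, c) :: t); split.
  by move=> p; rewrite inE => /orP[/eqP->//|/tU].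
by move=> M b hb; have := te M b hb; rewrite /fsum !big_cons => ->.
Qed.

End Balanced.

Definition contract (E : fieldType) (W D : lmodType E) (f : D -> E^o) : W ⊗ D -> W :=
  tlift (fun w d => f d *: w).

Section Contract.
Variables (E : fieldType) (W D : lmodType E) (f : D -> E^o) (hf : linear f).

Lemma contract_linear : linear (contract f : W ⊗ D -> W).
Proof. exact: (tlift_linear (@counitr_bilinear E D W f hf)). Qed.

Lemma contractE (w : W) (d : D) : contract f (w ⊗ₜ d) = f d *: w.
Proof. exact: (tliftE _ _ (@counitr_bilinear E D W f hf)). Qed.

Lemma contract_sum (s : seq (W * D)) :
  contract f (\sum_(p <- s) p.1 ⊗ₜ p.2) = fsum (fun (w : W) d => f d *: w) s.
Proof.
rewrite /fsum; elim: s => [|p s ih].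
  by rewrite !big_nil (lin_zero contract_linear).
by rewrite !big_cons (lin_add contract_linear) contractE ih.
Qed.

End Contract.

Definition separating (E : fieldType) (D : lmodType E) (Phi : (D -> E^o) -> Prop) :=
  (forall f, Phi f -> linear f) /\
  forall (W : lmodType E) (U : W -> Prop) (t : W ⊗ D), subspace U ->
    (forall f, Phi f -> U (contract f t)) ->
    exists s : seq (W * D),
      (forall p, p \in s -> U p.1) /\ t = \sum_(p <- s) p.1 ⊗ₜ p.2.

Lemma separating_linear (F : fieldType) (C : lmodType F) :
  separating (fun f : C -> F^o => linear f).
Proof.
split=> // W U t hU h.
have [|s [sU e]] := @same_tensor_sub F W C U (repr t) hU.
  by move=> f hf; rewrite -contract_sum // -tens_sum; exact: h.
exists s; split=> //; rewrite [LHS]tens_sum; apply: (e _ (fun w c => w ⊗ₜ c)).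
have [bl br] := tens_bilinear W C.
split=> [c|w|a w c]; [exact: (lin_add (bl c))|exact: (lin_add (br w))|].
by rewrite (lin_scale (bl c)) (lin_scale (br w)).
Qed.

Section BaseChange.
Variables (F K : fieldType) (iota : {rmorphism F -> K}).

Lemma bchange_ind (V : lmodType F) (P : bchange iota V -> Prop) :
  P 0 -> (forall (x : K) v t, P t -> P (x *: incl iota v + t)) -> forall t, P t.
Proof.
move=> P0 PD t; rewrite (tens_sum (t : V ⊗ restr iota K^o)).
elim: (repr t) => [|p s ih]; first by rewrite big_nil.
by rewrite big_cons [X in X + _]tens_incl; exact: PD.
Qed.

Lemma incl0 (V : lmodType F) : incl iota (0 : V) = 0.
Proof. exact: semi_zero (@incl_semi _ _ iota _). Qed.

Definition bfun (C : lmodType F) (f : C -> F^o) : bchange iota C -> K^o :=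
  bext (fun c => iota (f c) : K^o).

Section Bfun.
Variables (C : lmodType F) (f : C -> F^o) (hf : linear f).

Lemma bfun_semi : Defs.semilinear iota (fun c : C => iota (f c) : K^o).
Proof. by move=> a u v; rewrite hf rmorphD rmorphM. Qed.

Lemma bfun_linear : linear (bfun f).
Proof. exact: (bext_linear bfun_semi). Qed.

Lemma bfunE c : bfun f (incl iota c) = iota (f c).
Proof. exact: (bextE bfun_semi). Qed.

End Bfun.

Definition is_bfun (C : lmodType F) (g : bchange iota C -> K^o) : Prop :=
  exists2 f : C -> F^o, linear f & g = bfun f.

Lemma tensor_bchange_sum (C : lmodType F) (W : lmodType K) (t : W ⊗ bchange iota C) :
  exists s : seq (W * C), t = \sum_(p <- s) p.1 ⊗ₜ incl iota p.2.
Proof.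
rewrite (tens_sum t); elim: (repr t) => [|[w d] r [s ih]].
  by exists [::]; rewrite !big_nil.
rewrite big_cons ih /=; move: d; apply: bchange_ind.
  exists s; rewrite -[RHS]add0r; congr (_ + _).
  exact: (lin_zero ((tens_bilinear _ _).2 w)).
move=> x c d [s' e]; exists ((x *: w, c) :: s'); rewrite big_cons -e addrA /=.
have [bl br] := tens_bilinear W (bchange iota C).
by rewrite (lin_add (br w)) (lin_scale (br w)) (lin_scale (bl _)).
Qed.

Lemma separating_bfun (C : lmodType F) : separating (@is_bfun C).
Proof.
split=> [_ [f hf ->]|W U t hU h]; first exact: bfun_linear.
have [r tr] := tensor_bchange_sum t.
have [bl br] := tens_bilinear W (bchange iota C).
have [||s [sU e]] := @same_tensor_sub F (restr iota W) C U r.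
- by split=> [|a u v]; [exact: hU.1|exact: hU.2].
- move=> f hf; have := h _ (ex_intro2 _ _ f hf erefl).
  rewrite tr -(big_map (fun p : W * C => (p.1, incl iota p.2)) xpredT
    (fun p => p.1 ⊗ₜ p.2)) contract_sum; last exact: bfun_linear.
  rewrite /fsum big_map; congr (U _); apply: eq_bigr => p _ /=.
  by rewrite bfunE.
exists [seq (p.1, incl iota p.2) | p <- s]; split.
  by move=> _ /mapP[p ps ->]; exact: sU.
rewrite big_map tr; apply: (e _ (fun (w : restr iota W) c => (w : W) ⊗ₜ incl iota c)).
split=> [c|w u v|a w c].
- exact: (lin_add (bl _)).
- by rewrite (semi_add (@incl_semi _ _ iota _)) (lin_add (br _)).
- rewrite (semi_scale (@incl_semi _ _ iota _)) (lin_scale (br _)).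
  exact: (lin_scale (bl _)).
Qed.

End BaseChange.

(** * Comodules as modules over functionals *)

Definition act (E : fieldType) (D : supercoalgType E) (W : supercomodType D)
  (f : D -> E^o) (w : W) : W := contract f (coact w).

Lemma act_linear (E : fieldType) (D : supercoalgType E) (W : supercomodType D)
  (f : D -> E^o) : linear f -> linear (act f : W -> W).
Proof. by move=> hf; exact: (linear_comp (contract_linear hf) (@coact_linear E D W)). Qed.

Section Action.
Variables (E : fieldType) (D : supercoalgType E) (Phi : (D -> E^o) -> Prop).
Hypothesis hPhi : separating Phi.

Definition stable (W : supercomodType D) (U : W -> Prop) : Prop :=
  [/\ subspace U, forall b u, U u -> U (par b u) &
      forall f, Phi f -> forall u, U u -> U (act f u)].

Lemma stable_subcomodule (W : supercomodType D) (U : W -> Prop) :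
  stable U -> subcomodule U.
Proof.
move=> [hU hp ha]; split=> //; [exact: hU.1|exact: hU.2|].
by move=> u Uu; apply: (hPhi.2 _ _ _ hU) => f hf; exact: ha.
Qed.

Lemma irreducible_stable (W : supercomodType D) (U : W -> Prop) :
  irreducible W -> stable U -> (exists2 u, U u & u <> 0) -> forall w, U w.
Proof.
move=> [_ irr] /stable_subcomodule/irr[h|//] [u Uu u0].
by case: u0; exact: h.
Qed.

Lemma contract_tmap (W W' : lmodType E) (h : W -> W') (f : D -> E^o) t :
  linear h -> linear f -> contract f (tmap h id t) = h (contract f t).
Proof.
move=> hh hf; have hi := @linear_id E D; move: t; apply: linear_ext.
- exact: (linear_comp (contract_linear hf) (tmap_linear hh hi)).
- exact: (linear_comp hh (contract_linear hf)).
- by move=> w d; rewrite tmapE // !contractE // (lin_scale hh).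
Qed.

Lemma act_hom (W W' : supercomodType D) (h : {linear W -> W'}) (f : D -> E^o) w :
  comod_hom h -> linear f -> act f (h w) = h (act f w).
Proof.
by move=> [_ hc] hf; rewrite /act hc contract_tmap // => a u v; exact: linearP.
Qed.

Lemma hom_act (W W' : supercomodType D) (h : {linear W -> W'}) :
  (forall b w, h (par b w) = par b (h w)) ->
  (forall f, Phi f -> forall w, act f (h w) = h (act f w)) -> comod_hom h.
Proof.
move=> hp ha; split=> // w; apply/eqP; rewrite -subr_eq0; apply/eqP.
have hh : linear h by move=> a u v; exact: linearP.
have [f hf|s [s0 ->]] := hPhi.2 _ _ (coact (h w) - tmap h id (coact w)) (subspace0 _).
  have hf' := hPhi.1 f hf; have hc := @contract_linear E W' D f hf'.
  rewrite addrC -scaleN1r hc contract_tmap // scaleN1r -[h _]/(h (act f w)).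
  by rewrite -ha // addNr.
rewrite big1_seq // => p /andP[_ /s0->].
exact: (lin_zero ((tens_bilinear W' D).1 _)).
Qed.

Lemma schur_odd (W : supercomodType D) (theta : {rmorphism E -> E}) (psi : W -> W) :
  irreducible W -> bijective theta -> Defs.semilinear theta psi ->
  (forall b w, psi (par b w) = par (~~ b) (psi w)) ->
  (forall f, Phi f -> forall w, act f (psi w) = psi (act f w)) ->
  (exists w, psi w <> 0) -> bijective psi.
Proof.
move=> irr [theta' _ thetaK] hs hp ha [w0 w00].
have psi0 := semi_zero hs.
have inj w : psi w = 0 -> w = 0.
  move=> pw; apply: contrapT => wn; apply: w00; move: w0.
  apply: (irreducible_stable irr); last by exists w.
  split=> [|b u pu|f hf u pu].
  - by split=> // a u v pu pv; rewrite hs pu pv scaler0 addr0.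
  - by rewrite hp pu (lin_zero (@par_linear _ W _)).
  - by rewrite -ha // pu (lin_zero (act_linear (hPhi.1 f hf))).
have sur w : exists u, psi u = w.
  move: w; apply: (irreducible_stable irr); last by exists (psi w0) => //; exists w0.
  split=> [|b _ [u <-]|f hf _ [u <-]].
  - split=> [|a _ _ [u <-] [v <-]]; first by exists 0.
    by exists (theta' a *: u + v); rewrite hs thetaK.
  - by exists (par (~~ b) u); rewrite hp negbK.
  - by exists (act f u); rewrite ha.
exists (fun w => sval (cid (sur w))) => w; last exact: svalP (cid (sur w)).
set u := sval _; have pu : psi u = psi w := svalP (cid (sur (psi w))).
apply/eqP; rewrite -subr_eq0; apply/eqP/inj.
by rewrite addrC -scaleN1r hs pu rmorphN1 scaleN1r addNr.
Qed.

End Action.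

Section BaseChangeAction.
Variables (F K : fieldType) (iota : {rmorphism F -> K}).
Variable C : supercoalgType F.

Lemma contract_bcomp (V : lmodType F) (f : C -> F^o) (t : V ⊗ C) : linear f ->
  contract (bfun f) (bcomp iota t) = incl iota (contract f t).
Proof.
move=> hf; move: t; apply: (@semi_ext F K iota V C (bchange iota V)).
- exact: (linear_semi (contract_linear (bfun_linear hf)) (@bcomp_semi _ _ iota V C)).
- exact: (semi_comp (@incl_semi _ _ iota _) (contract_linear hf)).
- move=> v c; rewrite bcompE !contractE //; last exact: bfun_linear.
  by rewrite bfunE // (semi_scale (@incl_semi _ _ iota _)).
Qed.

Variable V : supercomodType C.
Let VK : supercomodType (bchange iota C) := bchange iota V.

Lemma act_incl (f : C -> F^o) (v : V) : linear f ->
  act (bfun f) (incl iota v : VK) = incl iota (act f v).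
Proof.
move=> hf; rewrite /act [coact _](bcoactE iota (@coact_linear F C V)).
exact: contract_bcomp.
Qed.

Lemma bfun_act_linear (f : C -> F^o) : linear f -> linear (act (bfun f) : VK -> VK).
Proof. by move=> hf; apply/act_linear/bfun_linear. Qed.

Section Embed.
Hypothesis irrV : irreducible V.

(* The F-subspace V ⊗ x_1 + ... + V ⊗ x_n. *)
Fixpoint bspan (xs : seq K) (t : VK) : Prop :=
  if xs is x :: xs' then exists v : V, bspan xs' (t - x *: incl iota v) else t = 0.

Lemma bspanD xs a t u : bspan xs t -> bspan xs u -> bspan xs (iota a *: t + u).
Proof.
elim: xs t u => [|x xs ih] t u /=; first by move=> -> ->; rewrite scaler0 addr0.
move=> [v hv] [w hw]; exists (a *: v + w).
rewrite incl_semi scalerDr opprD addrACA scalerA mulrC -scalerA -scalerBr.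
exact: ih.
Qed.

Lemma bspan0 xs : bspan xs 0.
Proof.
elim: xs => [//|x xs ih] /=; exists 0.
by rewrite incl0 scaler0 subr0.
Qed.

Lemma bspan_map xs (g : V -> V) (h : VK -> VK) t : linear h ->
  (forall v, h (incl iota v) = incl iota (g v)) -> bspan xs t -> bspan xs (h t).
Proof.
move=> hh hg; elim: xs t => [|x xs ih] t /=; first by move=> ->; exact: lin_zero.
move=> [v /ih hv]; exists (g v); move: hv.
by rewrite (lin_sub hh) (lin_scale hh) hg.
Qed.

Lemma bspan_all t : exists xs, bspan xs t.
Proof.
move: t; apply: bchange_ind => [|x v t [xs h]]; first by exists [::].
by exists (x :: xs), v; rewrite addrAC subrr add0r.
Qed.

Lemma embed_irreducible (N : VK -> Prop) : stable (@is_bfun _ _ iota C) N ->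
  (exists2 t, N t & t <> 0) ->
  exists e : V -> VK, [/\ Defs.semilinear iota e, forall v, N (e v),
    forall b v, e (par b v) = par b (e v),
    forall f : C -> F^o, linear f -> forall v, e (act f v) = act (bfun f) (e v) &
    forall v, e v = 0 -> v = 0].
Proof.
move=> [hN hNp hNa] [t0 Nt0 t00]; have [xs] := bspan_all t0.
elim: xs t0 Nt0 t00 => [//|x xs ih] t0 Nt0 t00 [v0 h0].
have [[t [Nt ht tn]]|none] := pselect (exists t, [/\ N t, bspan xs t & t <> 0]).
  exact: (ih t).
pose R v t := N t /\ bspan xs (t - x *: incl iota v).
have RD a v w t u : R v t -> R w u -> R (a *: v + w) (iota a *: t + u).
  move=> [Nt ht] [Nu hu]; split; first exact: hN.2.
  rewrite incl_semi scalerDr opprD addrACA scalerA mulrC -scalerA -scalerBr.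
  exact: bspanD.
have Rmap (g : V -> V) (h : VK -> VK) v t : linear h ->
    (forall v, h (incl iota v) = incl iota (g v)) -> (forall t, N t -> N (h t)) ->
    R v t -> R (g v) (h t).
  move=> hh hg hNh [Nt /(bspan_map hh hg) ht]; split; first exact: hNh.
  by move: ht; rewrite addrC -scaleN1r hh (lin_scale hh) hg scaleN1r addrC.
have Rp b v t : R v t -> R (par b v) (par b t).
  apply: Rmap => [|w|u]; [exact: par_linear|exact: par_incl|exact: hNp].
have Ra f v t : linear f -> R v t -> R (act f v) (act (bfun f) t).
  move=> hf; apply: Rmap => [|w|u]; [exact: bfun_act_linear|exact: act_incl|].
  by apply: hNa; exists f.
have R0 : R 0 0.
  split; first exact: hN.1.
  by rewrite incl0 scaler0 subr0; exact: bspan0.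
have R0uniq t : R 0 t -> t = 0.
  move=> [Nt ht]; apply: contrapT => tn; apply: none; exists t; split=> //.
  by move: ht; rewrite incl0 scaler0 subr0.
have Runiq v t u : R v t -> R v u -> t = u.
  move=> h /(RD (-1) _ _ _ _)/(_ h); rewrite scaleN1r addNr => /R0uniq/eqP.
  by rewrite rmorphN1 scaleN1r addrC subr_eq0 => /eqP.
have Rv0 : R v0 t0 by split.
have v00 : v0 <> 0 by move=> v00; apply/t00/R0uniq; rewrite -v00.
have ex v : exists t, R v t.
  move: v; apply: (irreducible_stable (@separating_linear F C) irrV).
    split=> [|b u [t /Rp]|f hf u [t ht]]; last by exists (act (bfun f) t); exact: Ra.
    - split; first by exists 0.
      by move=> a u w [t ht] [s hs]; exists (iota a *: t + s); exact: RD.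
    - by move=> h; exists (par b t).
  by exists v0 => //; exists t0.
pose e v := sval (cid (ex v)); have eR v : R v (e v) := svalP (cid (ex v)).
have es : Defs.semilinear iota e.
  by move=> a u v; apply: (Runiq (a *: u + v)) => //; exact: RD.
have ep b v : e (par b v) = par b (e v) by apply: (Runiq (par b v)) => //; exact: Rp.
have ea (f : C -> F^o) : linear f -> forall v, e (act f v) = act (bfun f) (e v).
  by move=> hf v; apply: (Runiq (act f v)) => //; exact: Ra.
exists e; split=> // [v|v ev]; first by have [] := eR v.
apply: contrapT => vn; apply: t00; rewrite -(Runiq _ _ _ (eR v0) Rv0).
move: v0 {h0 Rv0 v00}.
apply: (irreducible_stable (@separating_linear F C) irrV); last by exists v.
split=> [|b u eu|f hf u eu].
- split=> [|a u w eu ew]; first by apply: R0uniq.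
  by rewrite es eu ew scaler0 addr0.
- by rewrite ep eu (lin_zero (@par_linear _ VK _)).
- by rewrite ea // eu (lin_zero (bfun_act_linear hf)).
Qed.

End Embed.

End BaseChangeAction.

(** * Galois descent and conjugates *)

Section Coefficients.
Variables (F K : fieldType) (iota : {rmorphism F -> K}) (V : lmodType F).

Lemma coefficient_neq0 (t : bchange iota V) : t <> 0 ->
  exists2 lam : restr iota K^o -> F^o, linear lam &
    contract lam (t : V ⊗ restr iota K^o) <> 0.
Proof.
move=> t0; apply: contrapT => nl; apply: t0.
have [lam hlam|s [s0 e]] := (separating_linear (restr iota K^o)).2 _ _
    (t : V ⊗ restr iota K^o) (subspace0 V).
  by apply: contrapT => nz; apply: nl; exists lam.
rewrite [t]e big1_seq // => p /andP[_ /s0->].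
exact: (lin_zero ((tens_bilinear V (restr iota K^o)).1 _)).
Qed.

Variables (lam : restr iota K^o -> F^o) (hlam : linear lam).
Let coef (t : bchange iota V) : V := contract lam (t : V ⊗ restr iota K^o).

Lemma coefficientD (x : K) v t :
  coef (x *: incl iota v + t) = lam (x : restr iota K^o) *: v + coef t.
Proof. by rewrite -tens_incl [LHS](lin_add (contract_linear hlam)) contractE. Qed.

Lemma coefficient0 : coef 0 = 0.
Proof. exact: (lin_zero (contract_linear hlam)). Qed.

Lemma coefficient_semi a t u : coef (iota a *: t + u) = a *: coef t + coef u.
Proof.
move: t; apply: bchange_ind => [|x v t ih]; first by rewrite coefficient0 !scaler0 !add0r.
rewrite scalerDr scalerA -addrA !coefficientD ih scalerDr -addrA scalerA.
by congr (_ *: _ + _); rewrite -[RHS](lin_scale hlam).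
Qed.

Lemma coefficient_map (g : V -> V) (h : bchange iota V -> bchange iota V) t :
  linear g -> linear h -> (forall v, h (incl iota v) = incl iota (g v)) ->
  coef (h t) = g (coef t).
Proof.
move=> hg hh e; move: t; apply: bchange_ind => [|x v t ih].
  by rewrite (lin_zero hh) coefficient0 (lin_zero hg).
by rewrite hh e !coefficientD hg ih.
Qed.

End Coefficients.

Section GaloisAction.
Variables (F K : fieldType) (iota : {rmorphism F -> K}).

Definition galois_one : galois_group iota :=
  @GaloisElt F K iota idfun (Bijective (fun=> erefl) (fun=> erefl)) (fun a => erefl).

Definition galois_comp (s t : galois_group iota) : galois_group iota.
Proof.
refine (@GaloisElt F K iota (gal_fun s \o gal_fun t) _ _).
  exact: bij_comp (gal_bij s) (gal_bij t).
by move=> a /=; rewrite !gal_fix.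
Defined.

Lemma galois_inverse (s : galois_group iota) :
  exists t : galois_group iota, cancel s t /\ cancel t s.
Proof.
have [t st ts] := gal_bij s.
pose tr : {rmorphism K -> K} := HB.pack t
  (GRing.isZmodMorphism.Build K K t (can2_zmod_morphism st ts))
  (GRing.isMonoidMorphism.Build K K t (can2_monoid_morphism st ts)).
have tF a : tr (iota a) = iota a by rewrite -[X in tr X](gal_fix s) /= st.
by exists (@GaloisElt F K iota tr (Bijective ts st) tF).
Qed.

Lemma semilinear_ext (s : {rmorphism K -> K}) (V : lmodType F) (U : lmodType K)
    (g h : bchange iota V -> U) :
  Defs.semilinear s g -> Defs.semilinear s h ->
  (forall v, g (incl iota v) = h (incl iota v)) -> g =1 h.
Proof.
move=> hg hh e; apply: bchange_ind => [|x v t ih]; last by rewrite hg hh e ih.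
by rewrite (semi_zero hg) (semi_zero hh).
Qed.

Lemma twist1_map (s : galois_group iota) (V : lmodType F) (g : V -> V)
    (h : bchange iota V -> bchange iota V) t :
  linear h -> (forall v, h (incl iota v) = incl iota (g v)) ->
  twist1 s (h t) = h (twist1 s t).
Proof.
move=> hh e; move: t; apply: (@semilinear_ext s).
- exact: (semi_comp (@twist1_semi _ _ _ s V) hh).
- exact: (linear_semi hh (@twist1_semi _ _ _ s V)).
- by move=> v; rewrite e !twist1_incl e.
Qed.

Lemma twist1_comp (s t : galois_group iota) (V : lmodType F) (u : bchange iota V) :
  twist1 s (twist1 t u) = twist1 (galois_comp s t) u.
Proof.
move: u; apply: (@semilinear_ext (galois_comp s t)).
- by move=> a x y; rewrite !twist1_semi.
- exact: twist1_semi.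
- by move=> v; rewrite !twist1_incl.
Qed.

Lemma bfun_twist1 (s : galois_group iota) (C : lmodType F) (f : C -> F^o) d :
  linear f -> bfun f (twist1 s d) = s (bfun f d : K) :> K.
Proof.
move=> hf; have hb := bfun_linear (iota := iota) hf; move: d.
apply: (@semilinear_ext s C K^o).
- exact: (linear_semi hb (@twist1_semi _ _ _ s C)).
- by move=> a x y /=; rewrite hb rmorphD rmorphM.
- by move=> c; rewrite twist1_incl !bfunE // gal_fix.
Qed.

Section Descent.
Hypothesis hsep : is_separable_closure iota.
Variable V : lmodType F.

Let expand (s : seq (K * V)) : bchange iota V := \sum_(p <- s) p.1 *: incl iota p.2.

Lemma twist1_fixed (t : bchange iota V) :
  (forall s : galois_group iota, twist1 s t = t) -> exists v, t = incl iota v.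
Proof.
move=> tfix.
have [r tr] : exists r : seq (restr iota K^o * V),
    t = \sum_(p <- r) (p.1 : K) *: incl iota p.2.
  move: {tfix} t; apply: bchange_ind => [|x v t [r ->]].
    by exists [::]; rewrite big_nil.
  by exists ((x, v) :: r); rewrite big_cons.
have [||r' [r'F e]] := @same_tensor_sub F (restr iota K^o) V
  (fun x => exists a, x = iota a) r.
- split=> [|a _ _ [b ->] [c ->]]; first by exists 0; rewrite rmorph0.
  by exists (a * b + c); rewrite rmorphD rmorphM.
- move=> f hf; rewrite [fsum _ _](_ : _ = bfun f t :> K).
    by apply: (fixed_field hsep) => s; rewrite -bfun_twist1 // tfix.
  have hb := bfun_linear (iota := iota) hf.
  rewrite tr /fsum; elim: r {tr} => [|p r ih]; first by rewrite !big_nil (lin_zero hb).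
  rewrite !big_cons hb bfunE // -ih; congr (_ + _); exact: mulrC.
have {}tr : t = \sum_(p <- r') (p.1 : K) *: incl iota p.2.
  rewrite tr; apply: (e _ (fun (x : restr iota K^o) v => (x : K) *: incl iota v)).
  split=> [v x y|x v w|a x v]; first exact: scalerDl.
    by rewrite (semi_add (@incl_semi _ _ iota _)) scalerDr.
  rewrite (semi_scale (@incl_semi _ _ iota _)) scalerA mulrC; congr (_ *: _).
rewrite tr; elim: r' r'F {e tr} => [|p r' ih] r'F.
  by exists 0; rewrite big_nil incl0.
have [|v hv] := ih; first by move=> q qr; apply: r'F; rewrite inE qr orbT.
have [a pa] := r'F p (mem_head _ _); exists (a *: p.2 + v).
by rewrite big_cons hv pa incl_semi.
Qed.

Lemma galois_descent (N : bchange iota V -> Prop) : subspace N ->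
  (forall (s : galois_group iota) t, N t -> N (twist1 s t)) ->
  (forall v, N (incl iota v) -> v = 0) -> forall t, N t -> t = 0.
Proof.
move=> hN hG hV t.
have [r ->] : exists r, t = expand r.
  move: t; apply: bchange_ind => [|x v t [r ->]].
    by exists [::]; rewrite /expand big_nil.
  by exists ((x, v) :: r); rewrite /expand big_cons.
have [n] := ubnP (size r); elim: n r => [//|n ih] [|[x v] r] /= sz.
  by rewrite /expand big_nil.
have [->|x0] := eqVneq x 0.
  by rewrite /expand big_cons scale0r add0r; exact: ih.
move=> /(subspaceZ hN x^-1); set u := x^-1 *: _ => Nu.
suff u0 : u = 0 by rewrite -[expand _](scalerKV x0) -/u u0 scaler0.
have twE (s : galois_group iota) : exists r',
    size r' = size r /\ twist1 s u - u = expand r'.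
  exists [seq (s (x^-1 * p.1) - x^-1 * p.1, p.2) | p <- r]; rewrite size_map; split=> //.
  have -> : u = incl iota v + \sum_(p <- r) (x^-1 * p.1) *: incl iota p.2.
    rewrite /u /expand big_cons scalerDr scalerA mulVf // scale1r scaler_sumr.
    by congr (_ + _); apply: eq_bigr => p _; rewrite scalerA.
  have hs := @twist1_semi _ _ _ s V.
  rewrite (semi_add hs) twist1_incl opprD addrACA subrr add0r /expand big_map.
  elim: (r) => [|p r' ihr]; first by rewrite !big_nil (semi_zero hs) subrr.
  rewrite !big_cons (semi_add hs) (semi_scale hs) twist1_incl opprD addrACA ihr /=.
  by rewrite scalerBl.
have ufix s : twist1 s u = u.
  have [r' [sz' e]] := twE s; apply/eqP; rewrite -subr_eq0; apply/eqP.
  rewrite e; apply: ih; first by rewrite sz'.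
  by rewrite -e; apply: subspaceB => //; exact: hG.
have [w uw] := twist1_fixed ufix.
by rewrite uw (hV w) ?incl0 // -uw.
Qed.

End Descent.

Section Conjugate.
Variables (C : supercoalgType F) (W : supercomodType (bchange iota C)).
Variable s : galois_group iota.

Lemma incl_bij : bijective (@incl K K s W).
Proof.
have [t [st ts]] := galois_inverse s.
pose b (w : W) (x : restr s K^o) := (t x : K) *: w.
have hb : bilinear_map b.
  split=> [x|w] a u v; rewrite /b /=; first by rewrite scalerDr !scalerA mulrC.
  by rewrite [t _](_ : _ = a * t u + t v) ?scalerDl ?scalerA // rmorphD rmorphM st.
have hg := tlift_linear hb; have hbE := fun w x => tliftE w x hb.
exists (tlift b : bchange s W -> W) => [w|].
  by rewrite /incl hbE /b rmorph1 scale1r.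
apply: bchange_ind => [|x w u ih].
  by rewrite [tlift b 0](lin_zero hg) incl0.
rewrite -tens_incl [tlift b _](lin_add hg) hbE (semi_add (@incl_semi _ _ s _)) ih.
by rewrite tens_incl /b (semi_scale (@incl_semi _ _ s _)) ts.
Qed.

Lemma conjugate_act (f : C -> F^o) w : linear f ->
  act (bfun f) (incl s w : conjugate s W) = incl s (act (bfun f) w).
Proof.
move=> hf; have hb := bfun_linear (iota := iota) hf.
have hc := @coact_linear K (bchange iota C) W.
have hi := @linear_id K (bchange s W); have ht := @twist_linear _ _ _ s C.
have htm := tmap_linear hi ht.
have H (t : W ⊗ bchange iota C) : contract (bfun f)
    (tmap (id : bchange s W -> bchange s W) (@twist _ _ _ s C) (bcomp s t)) =
    incl s (contract (bfun f) t).
  move: t; apply: (@semi_ext K K s W (bchange iota C) (bchange s W)).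
  - have h := linear_comp (contract_linear (W := bchange s W) hb) htm.
    exact: (linear_semi h (@bcomp_semi _ _ s W (bchange iota C))).
  - exact: (semi_comp (@incl_semi _ _ s _) (contract_linear hb)).
  - move=> u d; rewrite bcompE (tmapE hi ht) !contractE //.
    rewrite (semi_scale (@incl_semi _ _ s _)); congr (_ *: _).
    by rewrite /twist (bextE (@twist1_semi _ _ _ s C)) bfun_twist1.
rewrite /act -H; congr (contract _ (tmap _ _ _)); exact: (bcoactE _ hc).
Qed.

End Conjugate.
End GaloisAction.

Definition linear_map (E : fieldType) (U V : lmodType E) (f : U -> V)
    (hf : linear f) : {linear U -> V} :=
  HB.pack f (GRing.isLinear.Build E U V *:%R f hf).

(* w |-> w ⊗ 1 is a semilinear identification of W with its conjugate. *)
Lemma conjugate_parity_isoP (F K : fieldType) (iota : {rmorphism F -> K})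
    (C : supercoalgType F) (W : supercomodType (bchange iota C)) :
  (exists s : galois_group iota, comod_iso (parity_change W) (conjugate s W)) <->
  (exists (s : galois_group iota) (psi : W -> W),
    [/\ Defs.semilinear s psi, bijective psi,
        forall b w, psi (par b w) = par (~~ b) (psi w) &
        forall f : C -> F^o, linear f ->
          forall w, act (bfun f) (psi w) = psi (act (bfun f) w)]).
Proof.
split=> [[s [h hh hb]]|[s [psi [ps pb pp pa]]]]; have [t [st ts]] := galois_inverse s.
- have [g gK Kg] := incl_bij W s; exists t, (fun w => g (h w)).
  have hs := @incl_semi _ _ s W; have gi := can_inj gK.
  have hpar b (w : W) : h (par (~~ b) w) = par b (h w) := hh.1 b w.
  split.
  + move=> a u v; apply: gi; rewrite hs !Kg ts -/(h _).
    exact: linearP.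
  + by apply: (bij_comp _ hb); exists (@incl _ _ s W).
  + by move=> b w; apply: gi; rewrite Kg -par_incl Kg -hpar negbK.
  + move=> f hf w; apply: gi; rewrite -conjugate_act // !Kg.
    exact: (act_hom (w : parity_change W) hh (bfun_linear hf)).
- exists t; have hs := @incl_semi _ _ t W.
  have hl : linear (fun w : parity_change W => incl t (psi w) : conjugate t W).
    by move=> a u v; rewrite [psi _]ps hs st.
  exists (linear_map hl); last exact: (bij_comp (incl_bij W t) pb).
  apply: (hom_act (separating_bfun iota C)) => [b w|_ [f hf ->] w] /=.
  + rewrite [psi _](pp (~~ b) w) negbK; exact/esym/par_incl.
  + by rewrite conjugate_act // pa.
Qed.

Lemma comod_iso_parity_changeP (F : fieldType) (C : supercoalgType F)
    (V : supercomodType C) (g : V -> V) : linear g -> bijective g ->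
  (forall b v, g (par b v) = par (~~ b) (g v)) ->
  (forall f : C -> F^o, linear f -> forall v, act f (g v) = g (act f v)) ->
  comod_iso V (parity_change V).
Proof.
move=> hg hb hp ha; have hg' : linear (g : V -> parity_change V) := hg.
exists (linear_map hg') => //.
by apply: (hom_act (separating_linear C)) => [b v|f hf v] /=; [exact: hp|exact: ha].
Qed.

Theorem proposition3p26 (F Fsep : fieldType) (iota : {rmorphism F -> Fsep})
    (hchar : 2%N \notin [pchar F])
    (hsep : is_separable_closure iota)
    (A : superHopfType F)
    (V : supercomodType A) (hV : irreducible V)
    (V' : supercomodType (bchange iota A)) (hV' : irreducible V')
    (j : {linear V' -> bchange iota V})
    (hj : comod_hom j) (hj_inj : injective j) :
  comod_iso V (parity_change V) <->
  exists sigma : galois_group iota,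
    comod_iso (parity_change V') (conjugate sigma V').
Proof.
have hjl : linear j by move=> a u v; exact: linearP.
have [hjp _] := hj.
have hja (f : A -> F^o) w : linear f -> act (bfun f) (j w) = j (act (bfun f) w).
  by move=> hf; exact: (act_hom w hj (bfun_linear hf)).
have [w0 w00] := hV'.1; have [v0 v00] := hV.1.
have j0 w : j w = 0 -> w = 0 by move=> h; apply: hj_inj; rewrite h linear0.
have [e [es ep ea einj]] : exists e : V -> V', [/\ Defs.semilinear iota e,
    forall b v, e (par b v) = par b (e v),
    forall f : A -> F^o, linear f -> forall v, e (act f v) = act (bfun f) (e v) &
    forall v, e v = 0 -> v = 0].
  have [||e [es eN ep ea e0]] := @embed_irreducible F Fsep iota A V hV
      (fun t => exists w, j w = t).
  - split=> [|b _ [w <-]|_ [f hf ->] _ [w <-]].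
    + split=> [|a _ _ [u <-] [w <-]]; first by exists 0; rewrite linear0.
      by exists (a *: u + w); rewrite hjl.
    + by exists (par b w).
    + by exists (act (bfun f) w); rewrite hja.
  - by exists (j w0); [exists w0|move=> /j0].
  pose e' v := sval (cid (eN v)); have je v : j (e' v) = e v := svalP (cid (eN v)).
  exists e'; split=> [a u v|b v|f hf v|v h].
  - by apply: hj_inj; rewrite hjl !je.
  - by apply: hj_inj; rewrite hjp !je.
  - by apply: hj_inj; rewrite -hja // !je ea.
  - by apply: e0; rewrite -je h linear0.
rewrite conjugate_parity_isoP; split.
- move=> [g hg [g' gK Kg]].
  have hgl : linear (g : V -> V) by move=> a u v; exact: (linearP g).
  have hg'l : linear (g' : V -> V).
    by move=> a u v; apply: (can_inj gK); rewrite [RHS]hgl !Kg.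
  have gp b v : g (par b v) = par (~~ b) (g v : V) := hg.1 b v.
  have ga (f : A -> F^o) v : linear f -> act f (g v : V) = g (act f v).
    by move=> hf; exact: (act_hom v hg hf).
  have hi := @incl_semi _ _ iota V.
  have hgs := semi_comp hi hgl; have hg's := semi_comp hi hg'l.
  pose gK' := bext (f := iota) (incl iota (V := V) \o (g : V -> V)).
  have hgK : linear gK' := bext_linear hgs.
  have gKE v : gK' (incl iota v) = incl iota (g v : V) := bextE hgs v.
  have gKinj t : gK' t = 0 -> t = 0.
    pose g'K := bext (f := iota) (incl iota (V := V) \o (g' : V -> V)).
    have hg'K : linear g'K := bext_linear hg's.
    suff can u : g'K (gK' u) = u by move=> h; rewrite -[t]can h (lin_zero hg'K).
    move: u; apply: bchange_ext => [||v]; [exact: (linear_comp hg'K hgK)|by []|].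
    by rewrite gKE [LHS](bextE hg's) /= gK.
  pose eK := bext (f := iota) e.
  have heK : linear eK := bext_linear es.
  have eKE v : eK (incl iota v) = e v := bextE es v.
  have eKp b t : eK (par b t) = par b (eK t).
    move: t; apply: bchange_ext => [||v].
    + exact: (linear_comp heK (par_linear b)).
    + exact: (linear_comp (par_linear b) heK).
    + by rewrite par_incl !eKE.
  have eKa (f : A -> F^o) t : linear f -> eK (act (bfun f) t) = act (bfun f) (eK t).
    move=> hf; have hb := bfun_linear (iota := iota) hf.
    move: t; apply: bchange_ext => [||v].
    + exact: (linear_comp heK (act_linear hb)).
    + exact: (linear_comp (act_linear hb) heK).
    + by rewrite act_incl // !eKE ea.
  have gKp b t : gK' (par b t) = par (~~ b) (gK' t).
    move: t; apply: bchange_ext => [||v].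
    + exact: (linear_comp hgK (par_linear b)).
    + exact: (linear_comp (par_linear (~~ b)) hgK).
    + by rewrite par_incl !gKE gp par_incl.
  have gKa (f : A -> F^o) t : linear f -> gK' (act (bfun f) t) = act (bfun f) (gK' t).
    move=> hf; have hb := bfun_linear (iota := iota) hf.
    move: t; apply: bchange_ext => [||v].
    + exact: (linear_comp hgK (act_linear hb)).
    + exact: (linear_comp (act_linear hb) hgK).
    + by rewrite act_incl // !gKE act_incl // ga.
  have [s hs] : exists s : galois_group iota, eK (twist1 s (gK' (j w0))) <> 0.
    apply: contrapT => none; apply/w00/j0/gKinj.
    apply: (galois_descent hsep (N := fun t =>
      forall s : galois_group iota, eK (twist1 s t) = 0)).
    + split=> [s|a t u ht hu s]; have hs := @twist1_semi _ _ _ s V.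
        by rewrite (semi_zero hs) (lin_zero heK).
      by rewrite hs heK ht hu scaler0 addr0.
    + by move=> s t ht s'; rewrite twist1_comp.
    + by move=> v /(_ (galois_one iota)); rewrite twist1_incl eKE; exact: einj.
    + by move=> s; apply: contrapT => hs; apply: none; exists s.
  have hss := @twist1_semi _ _ _ s V.
  pose psi w := eK (twist1 s (gK' (j w))).
  have psis : Defs.semilinear s psi.
    by move=> a u v; rewrite /psi hjl hgK hss heK.
  have psip b w : psi (par b w) = par (~~ b) (psi w).
    rewrite /psi hjp gKp -eKp; congr (eK _).
    by apply: (@twist1_map _ _ _ s V (par (~~ b))); [exact: par_linear|exact: par_incl].
  have psia (f : A -> F^o) : linear f ->
      forall w, act (bfun f) (psi w) = psi (act (bfun f) w).
    move=> hf w; rewrite /psi -hja // gKa // -eKa //; congr (eK _).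
    by symmetry; apply: (@twist1_map _ _ _ s V (act f)) => [|v];
      [exact/act_linear/bfun_linear|exact: act_incl].
  exists s, psi; split=> //.
  apply: (schur_odd (separating_bfun iota A) hV' (gal_bij s) psis psip) => [_ [f hf ->]|].
    exact: psia.
  by exists w0.
- move=> [s [psi [ps pb pp pa]]].
  have [lam hlam lam0] : exists2 lam : restr iota Fsep^o -> F^o, linear lam &
      contract lam (j (psi (e v0)) : V ⊗ restr iota Fsep^o) <> 0.
    apply: coefficient_neq0 => /j0 h; apply/v00/einj/(bij_inj pb).
    by rewrite h (semi_zero ps).
  pose d v : V := contract lam (j (psi (e v)) : V ⊗ restr iota Fsep^o).
  have hd : linear d.
    move=> a u v; rewrite /d es ps gal_fix hjl; exact: (coefficient_semi hlam).
  have dp b v : d (par b v) = par (~~ b) (d v).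
    rewrite /d ep pp hjp.
    apply: (coefficient_map hlam (h := par (~~ b))); [| |exact: par_incl];
      exact: par_linear.
  have da (f : A -> F^o) : linear f -> forall v, act f (d v) = d (act f v).
    move=> hf v; rewrite /d ea // -pa // -hja //; symmetry.
    apply: (coefficient_map hlam (h := act (bfun f))) => [||u]; last exact: act_incl.
      exact: act_linear.
    exact/act_linear/bfun_linear.
  apply: (comod_iso_parity_changeP hd) => //.
  apply: (schur_odd (separating_linear A) hV (theta := idfun)) => //.
    by exists id.
  by exists v0.
Qed.
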